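(* Let $\tau\in\mathbb C$ with $t=\mathrm{Im}\,\tau>0$, and let $K\in\mathrm{Mat}_{g\times g}(\mathbb Z)$ be any symmetric positive definite matrix. Let $\mathcal C$ be the associated holomorphic vector bundle of rank $\delta=\det K$ on $\widehat A=\mathbb C^g/(\mathbb Z^g+\tau\mathbb Z^g)$, with natural identifications $\mathcal C|_{[\vec\xi]}\cong\mathsf W_{K,\vec\xi}$ for $\vec\xi\in\mathbb C^g$, and let $h_c$ be the hermitian metric on $\mathcal C$ defined by the scalar products on the spaces $\mathsf W_{K,\vec\xi}$ (see context). Then the Bott--Chern connection of the hermitian holomorphic vector bundle $(\mathcal C,h_c)$ is projectively flat.
   Context: $E=\mathbb C/(\mathbb Z+\tau\mathbb Z)$, $\Omega=\tau K$, $A=\mathbb C^g/(\mathbb Z^g+\tau\mathbb Z^g)=E^g$, $B=\mathbb C^g/(\mathbb Z^g+\Omega\mathbb Z^g)$, $\kappa:A\to B$, $[\vec z]\mapsto[K\vec z]$. $\mathcal T$ is the line bundle on $B$ whose sections satisfy $f(\vec z+\vec m)=f(\vec z)$, $f(\vec z+\Omega\vec m)=\exp(-\pi i\,\vec m^t(2\vec z+\Omega\vec m))f(\vec z)$ for $\vec m\in\mathbb Z^g$, and $\mathcal R=\kappa^*\mathcal T$. The dual torus $\widehat A$ is identified with $A$ as follows. Let $\mathcal Q$ be the Poincaré bundle on $E\times E$ whose sections are functions $F(\xi,z)$ with $F(\xi+1,z)=F(\xi,z)=F(\xi,z+1)$, $F(\xi+\tau,z)=\exp(-2\pi iz)F(\xi,z)$,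 $F(\xi,z+\tau)=\exp(-2\pi i\xi)F(\xi,z)$; the Poincaré bundle on $\widehat A\times A=A\times A$ is $\mathcal P=\bigotimes_{i=1}^g\pi_{i,g+i}^*\mathcal Q$, where $\pi_{i,g+i}(\vec\xi,\vec z)=(\xi_i,z_i)$. With $p_1,p_2:\widehat A\times A\to\widehat A,A$ the projections, $\mathcal C=Rp_{1*}(\mathcal P\otimes p_2^*\mathcal R)$ is the Fourier--Mukai transform of $\mathcal R$; it is a vector bundle of rank $\delta$. For $\vec\xi\in\mathbb C^g$, $\mathsf W_{K,\vec\xi}$ is the space of holomorphic $H:\mathbb C^g\to\mathbb C$ with $H(\vec z+\vec l)=H(\vec z)$ and $H(\vec z+\tau\vec l)=\exp\bigl(-\pi i\,\vec l^{\,t}(2\vec\xi+2K\vec z+\Omega\vec l)\bigr)H(\vec z)$ for all $\vec l\in\mathbb Z^g$; it is the space of sections of $(\mathcal P\otimes p_2^*\mathcal R)|_{\{[\vec\xi]\}\times A}$, which gives $\mathcal C|_{[\vec\xi]}\cong\mathsf W_{K,\vec\xi}$. Writing $\vec\xi=\tau\vec a+\vec b$ and $\vec z=\vec x+\tau\vec y$ with real vectors, the scalar product is $\langle\Phi_1,\Phi_2\rangle=\int_{[0,1]^{2g}}\exp\bigl(-2\pi t\,\vec y^{\,t}(K\vec y+2\vec a)\bigr)\Phi_1\overline{\Phi_2}\,d\vec x\,d\vec y$. The Bott--Chern connection (Chern connection) of a hermitian holomorphic bundle is the unique hermitian connection whose $(0,1)$-part is the $\bar\partial$-operator of the holomorphic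 structure; it is projectively flat if its curvature is a scalar 2-form times the identity. *)

(* Defs.v *)
(* The torus C^g / (Z^g + tau Z^g) is handled on its universal covering C^g:
   functions on the torus are lattice-periodic functions on C^g, and sections of
   bundles over it are functions obeying the automorphy relations. *)
From HB Require Import structures.
From mathcomp Require Import all_boot all_order all_algebra.
From mathcomp Require Import all_classical all_reals all_analysis.
From mathcomp Require Export complex.

Set Implicit Arguments.
Unset Strict Implicit.
Unset Printing Implicit Defensive.
Import Order.TTheory GRing.Theory Num.Theory numFieldNormedType.Exports.

Local Open Scope classical_set_scope.
Local Open Scope ring_scope.
Local Open Scope complex_scope.

(* The usual topology of C, induced by the modulus. *)
HB.instance Definition _ (R : realType) := NormedModule.copy R[i] R[i]^o.

Section Calculus.
Variable R : realType.

Definition cexp (z : R[i]) : R[i] :=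
  (expR (complex.Re z))%:C * (cos (complex.Im z) +i* sin (complex.Im z)).

Section RealDerivatives.
Variable V : normedModType R[i].

(* Derivative at p along the real line s |-> p + s v.  The directions v range
   over V as a real vector space: v and i v are independent directions. *)
Definition rderivable (v : V) (f : V -> R[i]) (p : V) : Prop :=
  derivable (fun s : R => complex.Re (f (p + s%:C *: v))) 0 1 /\
  derivable (fun s : R => complex.Im (f (p + s%:C *: v))) 0 1.

Definition rderive (v : V) (f : V -> R[i]) (p : V) : R[i] :=
  derive1 (fun s : R => complex.Re (f (p + s%:C *: v))) 0 +i*
  derive1 (fun s : R => complex.Im (f (p + s%:C *: v))) 0.

(* C^n and C^oo in the real sense. *)
Fixpoint Cn (n : nat) (f : V -> R[i]) : Prop :=
  match n with
  | 0 => continuous f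
  | n'.+1 => continuous f /\
      forall v, (forall p, rderivable v f p) /\ Cn n' (rderive v f)
  end.

Definition smooth (f : V -> R[i]) : Prop := forall n, Cn n f.

(* Complex differentiability at every point. *)
Definition holomorphic (f : V -> R[i]) : Prop := forall p, differentiable f p.

End RealDerivatives.

(* (0,1)-part of an R-linear map alpha on a complex vector space:
   alpha^{0,1}(v) = (alpha(v) + i alpha(i v)) / 2. *)
Definition part01 (V : lmodType R[i]) (alpha : V -> R[i]) (v : V) : R[i] :=
  2^-1 * (alpha v + 'i%C * alpha ('i%C *: v)).

(* Integral over the unit cube [0,1]^n as an iterated Lebesgue integral (by
   Fubini the n-dimensional integral; only continuous integrands occur). *)
Fixpoint cube_integral (n : nat) : ('cV[R]_n -> R) -> R :=
  match n with
  | 0 => fun f => f 0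
  | n'.+1 => fun f =>
      \int[lebesgue_measure]_(s in `[0, 1])
        cube_integral (fun u : 'cV[R]_n' => f (col_mx (s%:M : 'cV[R]_1) u))
  end.

Definition cube_cintegral (n : nat) (f : 'cV[R]_n -> R[i]) : R[i] :=
  cube_integral (fun w => complex.Re (f w)) +i*
  cube_integral (fun w => complex.Im (f w)).

End Calculus.

(* u^t v, without complex conjugation. *)
Definition dotv (A : pzRingType) (g : nat) (u v : 'cV[A]_g) : A :=
  (u^T *m v) 0 0.

Definition posdef (R : realType) (g : nat) (K : 'M[int]_g) : Prop :=
  forall x : 'cV[R]_g, x != 0 -> 0 < dotv x (map_mx intr K *m x).

Section FourierMukai.
Variables (R : realType) (g : nat) (tau : R[i]) (K : 'M[int]_g).

Local Notation CV := ('cV[R[i]]_g).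
Local Notation KC := (map_mx intr K : 'M[R[i]]_g).
Local Notation ofZ l := (map_mx intr l : CV).
Local Notation ofR x := (map_mx (fun r : R => r%:C) x : CV).
Local Notation piC := ((pi : R)%:C).

(* The space W_{K,xi} of sections of (P (x) p_2^* R) on {[xi]} x A; Omega = tau K. *)
Definition Wspace (xi : CV) (H : CV -> R[i]) : Prop :=
  [/\ holomorphic H,
      forall (l : 'cV[int]_g) z, H (z + ofZ l) = H z
    & forall (l : 'cV[int]_g) z,
        H (z + tau *: ofZ l) =
        cexp (- piC * 'i%C *
              dotv (ofZ l) (2 *: xi + 2 *: (KC *m z) + tau *: KC *m ofZ l))
        * H z].

(* The real vector a in xi = tau a + b. *)
Definition tau_coord (xi : CV) : 'cV[R]_g :=
  \col_j (complex.Im (xi j 0) / complex.Im tau).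

(* The scalar product on W_{K,xi}; a point of [0,1]^(2g) is the column (x, y). *)
Definition Wprod (xi : CV) (H1 H2 : CV -> R[i]) : R[i] :=
  cube_cintegral (fun w : 'cV[R]_(g + g) =>
    let x := usubmx w in
    let y := dsubmx w in
    let z := ofR x + tau *: ofR y in
    (expR (- 2 * pi * complex.Im tau *
           dotv y (map_mx intr K *m y + 2 *: tau_coord xi)))%:C
    * (H1 z * (H2 z)^*)).

(* Smooth functions on the dual torus. *)
Definition torus_function (f : CV -> R[i]) : Prop :=
  [/\ smooth f,
      forall (m : 'cV[int]_g) xi, f (xi + ofZ m) = f xi
    & forall (m : 'cV[int]_g) xi, f (xi + tau *: ofZ m) = f xi].

(* Global smooth sections of C = p_{1*}(P (x) p_2^* R).  A section assigns to xi
   an element Phi xi of the fibre W_{K,xi}, and the last two relations are the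
   xi-automorphy of the Poincare bundle (p_2^* R has none), by which W_{K,xi} and
   W_{K,xi'} are identified when [xi] = [xi'].  Holomorphic sections over an open
   set are those Phi that are holomorphic in (xi, z), since C is a direct image. *)
Definition C_section (Phi : CV -> CV -> R[i]) : Prop :=
  [/\ smooth (fun p : CV * CV => Phi p.1 p.2),
      forall xi, Wspace xi (Phi xi),
      forall (m : 'cV[int]_g) xi z, Phi (xi + ofZ m) z = Phi xi z
    & forall (m : 'cV[int]_g) xi z,
        Phi (xi + tau *: ofZ m) z =
        cexp (- (2 * piC * 'i%C * dotv (ofZ m) z)) * Phi xi z].

(* The metric h_c evaluated on two sections. *)
Definition h_c (Phi Psi : CV -> CV -> R[i]) (xi : CV) : R[i] :=
  Wprod xi (Phi xi) (Psi xi).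

(* In R[i], 0 < c means that c is real and positive. *)
Definition hermitian_metric : Prop :=
  [/\ forall xi (c : R[i]) H1 H2 H3, Wspace xi H1 -> Wspace xi H2 ->
        Wspace xi H3 ->
        Wprod xi (fun z => c * H1 z + H2 z) H3 =
        c * Wprod xi H1 H3 + Wprod xi H2 H3,
      forall xi H1 H2, Wspace xi H1 -> Wspace xi H2 ->
        Wprod xi H2 H1 = (Wprod xi H1 H2)^*,
      forall xi H, Wspace xi H -> (exists z, H z != 0) -> 0 < Wprod xi H H
    & forall Phi Psi, C_section Phi -> C_section Psi ->
        torus_function (h_c Phi Psi)].

(* The dbar-operator of the holomorphic structure of C: holomorphic sections
   being the functions holomorphic in (xi, z), it differentiates the function
   Phi(xi, z) with respect to the conjugate of xi. *)
Definition dbar (Phi : CV -> CV -> R[i]) (v xi z : CV) : R[i] :=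
  part01 (fun u => rderive u (Phi ^~ z) xi) v.

(* Connections, as operators on global smooth sections.  Vectors v of C^g are
   real tangent vectors, regarded as constant vector fields on the torus; these
   trivialize the tangent bundle, so that a 1-form is given by its values on
   them, and they commute, so that the curvature below has no bracket term. *)
Record connection (nabla : CV -> (CV -> CV -> R[i]) -> CV -> CV -> R[i]) :
    Prop := Connection {
  connection_section : forall v Phi, C_section Phi -> C_section (nabla v Phi);
  connection_dirD : forall u v Phi, C_section Phi -> forall xi z,
    nabla (u + v) Phi xi z = nabla u Phi xi z + nabla v Phi xi z;
  connection_dirZ : forall (r : R) v Phi, C_section Phi -> forall xi z,
    nabla (r%:C *: v) Phi xi z = r%:C * nabla v Phi xi z;
  connectionD : forall v Phi Psi, C_section Phi -> C_section Psi ->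
    forall xi z,
    nabla v (fun xi' z' => Phi xi' z' + Psi xi' z') xi z =
    nabla v Phi xi z + nabla v Psi xi z;
  connection_Leibniz : forall v f Phi, torus_function f -> C_section Phi ->
    forall xi z,
    nabla v (fun xi' z' => f xi' * Phi xi' z') xi z =
    rderive v f xi * Phi xi z + f xi * nabla v Phi xi z }.

Record chern_connection (nabla : CV -> (CV -> CV -> R[i]) -> CV -> CV -> R[i]) :
    Prop := ChernConnection {
  chern_is_connection : connection nabla;
  chern_hermitian : forall v Phi Psi, C_section Phi -> C_section Psi ->
    forall xi, rderive v (h_c Phi Psi) xi =
               h_c (nabla v Phi) Psi xi + h_c Phi (nabla v Psi) xi;
  chern_dbar : forall v Phi, C_section Phi -> forall xi z,
    part01 (fun u => nabla u Phi xi z) v = dbar Phi v xi z }.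

Definition curvature (nabla : CV -> (CV -> CV -> R[i]) -> CV -> CV -> R[i])
    (u v : CV) (Phi : CV -> CV -> R[i]) (xi z : CV) : R[i] :=
  nabla u (nabla v Phi) xi z - nabla v (nabla u Phi) xi z.

(* Smooth complex-valued 2-forms on the dual torus. *)
Record two_form (omega : CV -> CV -> CV -> R[i]) : Prop := TwoForm {
  two_form_smooth : forall u v, torus_function (omega u v);
  two_form_alternating : forall u xi, omega u u xi = 0;
  two_formDl : forall u u' v xi,
    omega (u + u') v xi = omega u v xi + omega u' v xi;
  two_formDr : forall u v v' xi,
    omega u (v + v') xi = omega u v xi + omega u v' xi;
  two_formZl : forall (r : R) u v xi,
    omega (r%:C *: u) v xi = r%:C * omega u v xi;
  two_formZr : forall (r : R) u v xi,
    omega u (r%:C *: v) xi = r%:C * omega u v xi }.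

Definition projectively_flat
    (nabla : CV -> (CV -> CV -> R[i]) -> CV -> CV -> R[i]) : Prop :=
  exists2 omega : CV -> CV -> CV -> R[i], two_form omega
    & forall u v Phi, C_section Phi -> forall xi z,
        curvature nabla u v Phi xi z = omega u v xi * Phi xi z.

End FourierMukai.

(* Main.v *)
(* A section Phi of C becomes, after the translation
   G(xi, z) = Phi(xi, z - K^-1 xi), a function with values in the fixed space
   W_{K,0}, and completing the square in the weight turns h_c into the constant
   metric of W_{K,0} times exp(2 pi t a^t K^-1 a), where xi = tau a + b.  For a
   metric e^phi h_0 with h_0 constant the Chern connection is d + (del phi), so
   on Phi it is the derivative along (v, -K^-1 v) plus multiplication by
   -2 pi i a^t K^-1 v, and its curvature is scalar.  No basis of theta functions
   is needed: the metric property comes from differentiating under the integral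
   and from the vanishing of the integral of a derivative of a periodic function,
   and holomorphy in z of the covariant derivative from the symmetry of mixed
   derivatives and the Cauchy-Riemann equations.  For uniqueness, the difference
   A_v of two Chern connections satisfies A_{iv} = i A_v and is skew for h_c,
   hence h_c(A_v Phi, Psi) = 0 for all sections Psi, in particular for
   Psi = A_v Phi. *)
From HB Require Import structures.
Require Import Defs.
From mathcomp Require Import all_boot all_order all_algebra.
From mathcomp Require Import all_classical all_reals all_analysis.
From mathcomp Require Import complex.
From mathcomp Require Import ring lra.

Set Implicit Arguments.
Unset Strict Implicit.
Unset Printing Implicit Defensive.
Import Order.TTheory GRing.Theory Num.Theory numFieldNormedType.Exports.
Local Open Scope classical_set_scope.
Local Open Scope ring_scope.

(** * Integrals over the unit cube *)

(** The translation to G is not carried out in the code. Its trace is the direction (v, -K^-1 v),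
    along which xi + K z is constant, and with it the automorphy exponent of W_{K,xi}. The constants
    come from y^t (K y + 2 a) = (y + K^-1 a)^t K (y + K^-1 a) - a^t K^-1 a; as a = Im xi / t has del
    a = d xi / (2 i t), the form del (2 pi t a^t K^-1 a) takes the value -2 pi i a^t K^-1 v at v.
    The obstacle is analytic. [Cn] speaks only of derivatives along single real lines, so additivity
    in the direction, symmetry of mixed derivatives, and complex differentiability from the
    Cauchy-Riemann equations all have to be derived. The first two rest on writing increments as
    integrals over [0, 1] of one-variable derivatives. Such integrals depend continuously and
    differentiably on parameters because [0, 1] is compact: uniform estimates take the place of
    dominated convergence. The same facts, iterated over the coordinates, serve for h_c. *)

Section CubeIntegral.
Variable R : realType.
Local Notation mu := (@lebesgue_measure R).
Local Notation I01 f := (\int[mu]_(s in `[0%R, 1%R]) f s).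

Lemma continuous_integrable01 (f : R -> R) :
  continuous f -> mu.-integrable `[0, 1] (EFin \o f).
Proof.
move=> cf; apply: continuous_compact_integrable; first exact: segment_compact.
exact: continuous_subspaceT.
Qed.

Lemma integral01P (a : R) (f g : R -> R) : continuous f -> continuous g ->
  I01 (fun s => a * f s + g s) = a * I01 f + I01 g.
Proof.
move=> cf cg.
have caf : continuous (fun s => a * f s).
  by move=> x; apply: cvgM; [exact: cvg_cst|exact: cf].
rewrite RintegralD ?RintegralZl//; by [exact: continuous_integrable01|exact: measurable_itv].
Qed.

Lemma integral01_cst (c : R) : I01 (fun=> c) = c.
Proof.
rewrite Rintegral_cst//= lebesgue_measure_itv/= lte_fin ltr01.
by rewrite oppr0 adde0 mulr1.
Qed.

Lemma normr_integral01_le (e : R) (f : R -> R) : continuous f ->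
  (forall s, s \in `[0, 1] -> `|f s| <= e) -> `|I01 f| <= e.
Proof.
move=> cf fe; have if01 := continuous_integrable01 cf.
apply: (le_trans (le_normr_Rintegral _ if01)); first exact: measurable_itv.
rewrite -[leRHS]integral01_cst; apply: le_Rintegral.
- exact: measurable_itv.
- apply: continuous_integrable01 => x.
  by apply: cvg_norm; exact: cf.
- by apply: continuous_integrable01 => x; exact: cvg_cst.
- by move=> x /= x01; apply: fe.
Qed.

(** Tube lemma: by compactness of [0, 1], continuity of f at the points (p, s) is uniform in s.
    Around each x of the segment both values are compared with f (p, x), hence the halves of e. *)
Lemma tube_segment (P : topologicalType) (f : P * R -> R) (p : P) (e : R) :
  continuous f -> 0 < e ->
  \forall q \near p, forall s, s \in `[0, 1] -> `|f (q, s) - f (p, s)| <= e.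
Proof.
move=> cf e0.
have := (compact_near_coveringP (`[0%R, 1%R]%classic : set R)).1 (@segment_compact R 0 1).
move=> /(_ P (nbhs p) (fun q s => `|f (q, s) - f (p, s)| <= e) _) H.
have {}H := H _; apply: filterS (H _) => [q qs s s01|x _].
  exact: qs.
have /cvgrPdist_lt /(_ (e / 2)) := cf (p, x).
rewrite divr_gt0// => /(_ isT) [[U V] /= [Up Vx] UV].
exists (V, U) => //= -[s q] /= [Vs Uq].
have h1 := UV (q, s) (conj Uq Vs).
have h2 := UV (p, s) (conj (nbhs_singleton Up) Vs).
rewrite -(subrK (f (p, x)) (f (q, s))) -addrA.
rewrite (le_trans (ler_normD _ _))// [leRHS]splitr lerD//; last exact: ltW.
by rewrite distrC ltW.
Qed.

Lemma continuous_pairl (P Q : topologicalType) (T : topologicalType) (f : P * Q -> T) p :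
  continuous f -> continuous (fun q => f (p, q)).
Proof.
move=> cf q; apply: (@cvg_comp _ _ _ (fun q => (p, q)) f _ (nbhs (p, q))).
  by apply: cvg_pair => /=; [exact: cvg_cst|exact: cvg_id].
exact: cf.
Qed.

Lemma continuous_integral01 (P : topologicalType) (f : P * R -> R) :
  continuous f -> continuous (fun p => I01 (fun s => f (p, s))).
Proof.
move=> cf p; apply/cvgrPdist_le => e e0.
have := tube_segment p cf e0; apply: filterS => q qe.
rewrite distrC.
have := @integral01P (-1) (fun s => f (p, s)) (fun s => f (q, s)).
move=> /(_ (continuous_pairl cf) (continuous_pairl cf)).
rewrite mulN1r [RHS]addrC => <-.
apply: normr_integral01_le => [x|s s01].
  apply: cvgD; last exact: (continuous_pairl cf).
  by apply: cvgM; [exact: cvg_cst|exact: (continuous_pairl cf)].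
by rewrite mulN1r addrC qe.
Qed.

(** By the mean value theorem the difference quotient at s is [fd (c, s)] with c close to x, and
    [tube_segment] bounds its distance to [fd (x, s)] for all s at once. *)
Lemma is_derive_integral01 (f fd : R * R -> R) (x : R) :
  continuous f -> continuous fd ->
  (forall y s : R, is_derive y (1 : R) (fun y : R => f (y, s)) (fd (y, s))) ->
  is_derive x (1 : R) (fun y : R => I01 (fun s => f (y, s))) (I01 (fun s => fd (x, s))).
Proof.
move=> cf cfd df.
suff H : (fun h : R => h^-1 *: (I01 (fun s => f (h + x, s)) - I01 (fun s => f (x, s))))
         @ 0^' --> I01 (fun s => fd (x, s)).
  apply: DeriveDef.
    apply/cvg_ex; exists (I01 (fun s => fd (x, s))).
    by under eq_fun do rewrite [_ *: 1]mulr1.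
  rewrite /derive; under eq_fun do rewrite [_ *: 1]mulr1.
  exact/cvg_lim.
apply/cvgrPdist_le => e e0.
have /nbhs_ballP[d /= d0 de] := tube_segment x cfd e0.
near=> h.
have h0 : h != 0 by near: h; exact: nbhs_dnbhs_neq.
have hd : `|h| < d by near: h; apply: dnbhs0_lt.
have c1 (y : R) : continuous (fun s => f (y, s)) by exact: continuous_pairl.
have c1d (y : R) : continuous (fun s => fd (y, s)) by exact: continuous_pairl.
have -> : h^-1 *: (I01 (fun s => f (h + x, s)) - I01 (fun s => f (x, s))) =
   I01 (fun s => h^-1 * f (h + x, s) + (- h^-1) * f (x, s)).
  have c2 : continuous (fun s => - h^-1 * f (x, s)).
    by move=> y; apply: cvgM; [exact: cvg_cst|exact: c1].
  rewrite integral01P//.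
  have := @integral01P (- h^-1) (fun s => f (x, s)) (fun=> 0) (c1 x) (@cst_continuous _ _ 0).
  rewrite integral01_cst addr0; under eq_Rintegral do rewrite addr0.
  by move=> ->; rewrite /GRing.scale/= mulrBr mulNr.
have c3 : continuous (fun s => h^-1 * f (h + x, s) + - h^-1 * f (x, s)).
  move=> y; apply: cvgD; apply: cvgM; by [exact: cvg_cst|exact: c1].
rewrite distrC.
have := @integral01P (-1) _ _ (c1d x) c3.
rewrite mulN1r [RHS]addrC => <-.
apply: normr_integral01_le => [y|s s01].
  by apply: cvgD; [apply: cvgM; [exact: cvg_cst|exact: c1d]|exact: c3].
(* The point c depends on s, but the estimate is pointwise in s with a bound e independent of s, so
   no regularity of c in s is required. The sign of h decides on which side of x the mean value
   theorem is applied. *)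
have [c cx ->] : exists2 c, `|c - x| < d & h^-1 * f (h + x, s) + - h^-1 * f (x, s) = fd (c, s).
  have dc (a b : R) : {within `[a, b], continuous (fun y => f (y, s))}.
    apply: continuous_subspaceT => y.
    apply: differentiable_continuous; apply/derivable1_diffP.
    by have [] := df y s.
  have [hp|hn|h00] := ltgtP 0 h; last by rewrite -h00 eqxx in h0.
  - have [|c cI E] := @MVT R (fun y => f (y, s)) (fun y => fd (y, s)) x (h + x) _ (fun y _ => df y s) (dc _ _).
      by rewrite ltrDr.
    exists c.
      move: cI; rewrite in_itv/= => /andP[c1' c2'].
      rewrite ger0_norm ?subr_ge0 ?ltW// ltrBlDr (lt_trans c2')// ltrD2r.
      by rewrite (le_lt_trans _ hd)// ler_norm.
    by rewrite mulNr -mulrBr E addrK mulrCA mulVf// mulr1.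
  - have [|c cI E] := @MVT R (fun y => f (y, s)) (fun y => fd (y, s)) (h + x) x _ (fun y _ => df y s) (dc _ _).
      by rewrite gtrDr.
    exists c.
      move: cI; rewrite in_itv/= => /andP[c1' c2'].
      rewrite ler0_norm ?subr_le0 ?ltW// opprB ltrBlDr -ltrBlDl (lt_trans _ c1')// addrC ltrD2r.
      by move: hd; rewrite ler0_norm ?ltW// ltrNl.
    by rewrite mulNr -mulrBr -opprB E opprD addrCA subrr addr0 !mulrN opprK mulrCA mulVf// mulr1.
rewrite mulN1r addrC; apply: (de c) => //.
by rewrite /ball/= distrC.
Unshelve. all: by end_near.
Qed.

Lemma integral01_gt0 (f : R -> R) (s0 : R) : continuous f ->
  (forall s, 0 <= f s) -> s0 \in `[0, 1] -> 0 < f s0 -> 0 < I01 f.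
Proof.
move=> cf f0 s01 fs0.
have [a [b [ab J01 fJ]]] : exists a b : R, [/\ a < b,
    (`[a, b] `<=` `[0%R, 1%R])%classic & forall x, x \in `[a, b] -> f s0 / 2 <= f x].
  have /cvgrPdist_le /(_ (f s0 / 2)) := cf s0.
  rewrite divr_gt0// => /(_ isT) /nbhs_ballP[d /= d0 dP].
  have key x : `|s0 - x| < d -> f s0 / 2 <= f x.
    by move=> /dP /=; rewrite ler_norml => /andP[_]; lra.
  (* Since c is at most 1/2, an interval of length c starting at s0 stays in [0, 1] on the right if
     s0 is at most 1/2, and on the left otherwise. Since c < d, f keeps at least half of its value
     at s0 there. *)
  pose c := Num.min (d / 2) 2^-1.
  have c0 : 0 < c by rewrite lt_min divr_gt0//= invr_gt0.
  have cd : c < d.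
    by rewrite (le_lt_trans (y := d / 2))// ?ge_min ?lexx//; lra.
  have c2 : c <= 2^-1 by rewrite ge_min lexx orbT.
  move: s01; rewrite in_itv/= => /andP[s0g s0l].
  have [sl|sg] := leP s0 2^-1.
  - exists s0, (s0 + c); split; first by rewrite ltrDl.
      by move=> x /=; rewrite !in_itv/= => /andP[? ?]; apply/andP; split; lra.
    move=> x; rewrite in_itv/= => /andP[? ?]; apply: key.
    by rewrite ltr_norml; apply/andP; split; lra.
  - exists (s0 - c), s0; split; first by rewrite gtrDl oppr_lt0.
      by move=> x /=; rewrite !in_itv/= => /andP[? ?]; apply/andP; split; lra.
    move=> x; rewrite in_itv/= => /andP[? ?]; apply: key.
    by rewrite ltr_norml; apply/andP; split; lra.
have mf (c d : R) : mu.-integrable `[c, d] (EFin \o f).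
  apply: continuous_compact_integrable; first exact: segment_compact.
  exact: continuous_subspaceT.
apply: fine_gt0; apply/andP; split; last first.
  rewrite ltey_eq; apply/orP; left; apply: integrable_fin_num.
    exact: measurable_itv.
  exact: continuous_integrable01.
apply: (@lt_le_trans _ _ (\int[mu]_(x in `[a, b]) (f s0 / 2)%:E)%E).
  rewrite integral_cst//= lebesgue_measure_itv/= lte_fin ab.
  by rewrite -EFinB -EFinM lte_fin mulr_gt0 ?divr_gt0// subr_gt0.
apply: (@le_trans _ _ (\int[mu]_(x in `[a, b]) (f x)%:E)%E).
  apply: ge0_le_integral => //=.
  - by move=> x _; rewrite lee_fin divr_ge0// ltW.
  - by have /integrableP[] := mf a b.
apply: ge0_subset_integral => //=.
- by have /integrableP[] := mf 0 1.
- by move=> x _; rewrite lee_fin.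
Qed.

Lemma continuous_mx (T : topologicalType) (U : topologicalType) m n
    (M : T -> 'M[U]_(m, n)) :
  (forall i j, continuous (fun x => M x i j)) -> continuous M.
Proof.
move=> cM x A [P MP PA].
have : \forall y \near x, forall i, forall j, P i j (M y i j).
  apply: filter_forall => i; apply: filter_forall => j.
  exact: (cM i j x _ (MP i j)).
by apply: filterS => y yP; apply: PA.
Qed.

Lemma continuous_col_mx (T : topologicalType) n (f : T -> R) (h : T -> 'cV[R]_n) :
  continuous f -> continuous h ->
  continuous (fun x => col_mx ((f x)%:M : 'cV[R]_1) (h x)).
Proof.
move=> cf ch; apply: continuous_mx => i j.
case: (split_ordP i) => k ->.
  under eq_fun do rewrite col_mxEu !mxE !ord1 eqxx mulr1n.
  exact: cf.
under eq_fun do rewrite col_mxEd.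
move=> x; apply: (@continuous_comp _ _ _ h (fun N : 'cV[R]_n => N k j)).
  exact: ch.
exact: coord_continuous.
Qed.

Lemma continuous_fst (P Q : topologicalType) : continuous (@fst P Q).
Proof. by move=> x; exact: cvg_fst. Qed.

Lemma continuous_snd (P Q : topologicalType) : continuous (@snd P Q).
Proof. by move=> x; exact: cvg_snd. Qed.

Lemma continuous_compT (P Q S : topologicalType) (f : P -> Q) (h : Q -> S) :
  continuous f -> continuous h -> continuous (fun x => h (f x)).
Proof. by move=> cf ch x; apply: continuous_comp; [exact: cf|exact: ch]. Qed.

Lemma continuous_pairT (P Q S : topologicalType) (f : P -> Q) (h : P -> S) :
  continuous f -> continuous h -> continuous (fun x => (f x, h x)).
Proof. by move=> cf ch x; apply: cvg_pair; [exact: cf|exact: ch]. Qed.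

(** The induction runs over all parameter spaces: the outer variable of the cube becomes one more
    parameter of the inner integral. *)
Lemma continuous_cube_integral (P : topologicalType) n (F : P * 'cV[R]_n -> R) :
  continuous F -> continuous (fun p => cube_integral (fun w => F (p, w))).
Proof.
elim: n P F => [|n IH] P F cF /=.
  apply: (continuous_compT (f := fun p => (p, 0 : 'cV[R]_0))) => //.
  by apply: continuous_pairT => // x; [exact: cvg_id|exact: cvg_cst].
apply: (@continuous_integral01 P (fun ps => cube_integral
  (fun u : 'cV_n => F (ps.1, col_mx (ps.2)%:M u)))).
apply: (IH _ (fun psu => F (psu.1.1, col_mx (psu.1.2)%:M psu.2))).
apply: (continuous_compT (f := fun psu : (P * R) * 'cV[R]_n =>
  (psu.1.1, col_mx (psu.1.2)%:M psu.2))) => //.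
have c1 := @continuous_fst (P * R)%type 'cV[R]_n.
apply: continuous_pairT.
  by apply: continuous_compT c1 _; exact: continuous_fst.
apply: continuous_col_mx; last exact: continuous_snd.
by apply: continuous_compT c1 _; exact: continuous_snd.
Qed.

Lemma continuous_cube_slice n (f : 'cV[R]_n.+1 -> R) : continuous f ->
  continuous (fun su : R * 'cV[R]_n => f (col_mx (su.1)%:M su.2)).
Proof.
move=> cf; apply: continuous_compT cf; apply: continuous_col_mx.
  exact: continuous_fst.
exact: continuous_snd.
Qed.

Lemma cube_integralP n (a : R) (f h : 'cV[R]_n -> R) :
  continuous f -> continuous h ->
  cube_integral (fun w => a * f w + h w) = a * cube_integral f + cube_integral h.
Proof.
elim: n f h => [|n IH] f h cf ch //=.
rewrite -integral01P; last 2 first.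
- apply: (@continuous_cube_integral R n (fun su => f (col_mx (su.1)%:M su.2))).
  exact: continuous_cube_slice.
- apply: (@continuous_cube_integral R n (fun su => h (col_mx (su.1)%:M su.2))).
  exact: continuous_cube_slice.
apply: eq_Rintegral => s _; apply: IH.
  exact: (continuous_pairl (p := s) (continuous_cube_slice cf)).
exact: (continuous_pairl (p := s) (continuous_cube_slice ch)).
Qed.

Lemma cube_integral_cst n (c : R) : cube_integral (fun _ : 'cV[R]_n => c) = c.
Proof.
elim: n => [//|n IH] /=.
by under eq_Rintegral do rewrite IH; rewrite integral01_cst.
Qed.

Lemma cube_integral_ge0 n (f : 'cV[R]_n -> R) : (forall w, 0 <= f w) ->
  0 <= cube_integral f.
Proof.
elim: n f => [|n IH] f f0 //=.
by apply: Rintegral_ge0 => s _; exact: IH.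
Qed.

Lemma cube_integral_gt0 n (f : 'cV[R]_n -> R) (w0 : 'cV[R]_n) :
  continuous f -> (forall w, 0 <= f w) ->
  (forall i, w0 i 0 \in `[0, 1]) -> 0 < f w0 -> 0 < cube_integral f.
Proof.
elim: n f w0 => [|n IH] f w0 cf f0 w01 fw0 /=.
  by rewrite (flatmx0 w0) in fw0.
apply: (@integral01_gt0 _ (w0 0 0)) => //.
- apply: (@continuous_cube_integral R n (fun su => f (col_mx (su.1)%:M su.2))).
  exact: continuous_cube_slice.
- by move=> s; exact: cube_integral_ge0.
- apply: (IH _ (dsubmx (w0 : 'cV[R]_(1 + n)))) => //.
  + exact: (continuous_pairl (p := w0 0 0) (continuous_cube_slice cf)).
  + by move=> i; rewrite mxE.
  + suff -> : col_mx (w0 0 0)%:M (dsubmx (w0 : 'cV[R]_(1 + n))) = w0 by [].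
    rewrite -[RHS](@vsubmxK _ 1 n); congr col_mx.
    apply/matrixP => i j; rewrite !ord1 !mxE eqxx mulr1n.
    by congr (w0 _ _); apply/val_inj.
Qed.

Lemma is_derive_cube_integral n (f fd : R * 'cV[R]_n -> R) (x : R) :
  continuous f -> continuous fd ->
  (forall (y : R) w, is_derive y (1 : R) (fun y : R => f (y, w)) (fd (y, w))) ->
  is_derive x (1 : R) (fun y : R => cube_integral (fun w => f (y, w)))
    (cube_integral (fun w => fd (x, w))).
Proof.
elim: n f fd x => [|n IH] f fd x cf cfd df /=; first exact: (df x 0).
have slice (h : R * 'cV[R]_n.+1 -> R) : continuous h ->
    continuous (fun ysu : (R * R) * 'cV[R]_n =>
       h (ysu.1.1, col_mx (ysu.1.2)%:M ysu.2)).
  move=> ch; apply: (continuous_compT (f := fun psu : (R * R) * 'cV[R]_n =>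
    (psu.1.1, col_mx (psu.1.2)%:M psu.2))) => //.
  have c1 := @continuous_fst (R * R)%type 'cV[R]_n.
  apply: continuous_pairT.
    by apply: continuous_compT c1 _; exact: continuous_fst.
  apply: continuous_col_mx; last exact: continuous_snd.
  by apply: continuous_compT c1 _; exact: continuous_snd.
have sl2 (h : R * 'cV[R]_n.+1 -> R) (s : R) : continuous h ->
    continuous (fun yu : R * 'cV[R]_n => h (yu.1, col_mx s%:M yu.2)).
  move=> ch; apply: (continuous_compT (f := fun psu : R * 'cV[R]_n =>
    (psu.1, col_mx s%:M psu.2))) => //.
  apply: continuous_pairT; first exact: continuous_fst.
  by apply: continuous_col_mx; [exact: cst_continuous|exact: continuous_snd].
apply: (@is_derive_integral01
  (fun ys => cube_integral (fun u : 'cV_n => f (ys.1, col_mx (ys.2)%:M u)))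
  (fun ys => cube_integral (fun u : 'cV_n => fd (ys.1, col_mx (ys.2)%:M u)))).
- exact: (continuous_cube_integral (slice _ cf)).
- exact: (continuous_cube_integral (slice _ cfd)).
- move=> y s; apply: (IH (fun yu => f (yu.1, col_mx s%:M yu.2))
    (fun yu => fd (yu.1, col_mx s%:M yu.2))).
  + exact: sl2.
  + exact: sl2.
  + by move=> z w; exact: (df z (col_mx s%:M w)).
Qed.

Lemma integral01_derive (F f : R -> R) : continuous f ->
  (forall x : R, is_derive x (1 : R) F (f x)) -> I01 f = F 1 - F 0.
Proof.
move=> cf dF; rewrite /Rintegral.
have cF : continuous F.
  move=> x; apply: differentiable_continuous; apply/derivable1_diffP.
  by have [] := dF x.
rewrite (@continuous_FTC2 R f F 0 1) ?ltr01//.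
- exact: continuous_subspaceT.
- split.
  + by move=> x _; have [] := dF x.
  + by apply: cvg_at_right_filter; exact: cF.
  + by apply: cvg_at_left_filter; exact: cF.
- by move=> x _; rewrite derive1E; have [_ ->] := dF x.
Qed.

(** If j is the outermost coordinate, the integral over the slices is a function H of s whose
    derivative is the slice integral of fd, and periodicity gives H 1 = H 0. Otherwise the inner
    integral vanishes for each s by induction. *)
Lemma cube_integral_derive_periodic n (j : 'I_n) (f fd : 'cV[R]_n -> R) :
  continuous f -> continuous fd ->
  (forall w (y : R), is_derive y (1 : R)
     (fun s : R => f (w + s *: delta_mx j 0)) (fd (w + y *: delta_mx j 0))) ->
  (forall w, f (w + delta_mx j 0) = f w) ->
  cube_integral fd = 0.
Proof.
elim: n j f fd => [[]//|n IH] j f fd cf cfd df pf /=.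
have colE (k : 'I_(1 + n)) (s : R) (u : 'cV[R]_n) (y : R) (M1 : 'cV[R]_1) M2 :
    (delta_mx k 0 : 'cV[R]_(1 + n)) = col_mx M1 M2 ->
    col_mx s%:M u + y *: (delta_mx k 0 : 'cV[R]_(1 + n)) =
    col_mx (s%:M + y *: M1) (u + y *: M2).
  by move=> ->; rewrite scale_col_mx add_col_mx.
(* The same index, retyped so that [split_ordP] can separate the outer coordinate from the inner
   ones. *)
pose j' : 'I_(1 + n) := j.
case: (split_ordP j') => k jk.
- have dE : (delta_mx j' 0 : 'cV[R]_(1 + n)) = col_mx 1%:M 0.
    apply/matrixP => a b; rewrite !ord1 jk !mxE.
    by case: splitP => c ac; rewrite !mxE ?ord1 -val_eqE /= ac ?ord1.
  have sE (s : R) (u : 'cV[R]_n) :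
      col_mx (0 : R)%:M u + s *: (delta_mx j' 0 : 'cV[R]_(1 + n)) = col_mx s%:M u.
    by rewrite (colE _ _ _ _ _ _ dE) scaler0 addr0 scale_scalar_mx mulr1 -raddfD add0r.
  pose H s := cube_integral (fun u : 'cV[R]_n => f (col_mx s%:M u)).
  transitivity (H 1 - H 0); last first.
    apply/eqP; rewrite subr_eq0; apply/eqP; rewrite /H; congr cube_integral.
    apply/funext => u; rewrite -(sE 1) scale1r.
    by rewrite (pf (col_mx 0%:M u)).
  apply: integral01_derive.
  + apply: (continuous_cube_integral (continuous_cube_slice cfd)).
  + move=> x; apply: (@is_derive_cube_integral n
      (fun su => f (col_mx (su.1)%:M su.2)) (fun su => fd (col_mx (su.1)%:M su.2))).
    * exact: continuous_cube_slice.
    * exact: continuous_cube_slice.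
    * move=> y w /=; rewrite -(sE y) (_ : (fun s => _) = (fun s : R =>
        f ((col_mx 0%:M w : 'cV_n.+1) + s *: delta_mx j 0))).
        exact: (df (col_mx 0%:M w) y).
      by apply/funext => s; rewrite -(sE s).
- have dE : (delta_mx j' 0 : 'cV[R]_(1 + n)) = col_mx 0 (delta_mx k 0).
    apply/matrixP => a b; rewrite !ord1 jk !mxE.
    by case: splitP => c ac; rewrite !mxE ?ord1 -val_eqE /= ac ?ord1 ?eqn_add2l.
  rewrite -[RHS](integral01_cst 0); apply: eq_Rintegral => s _.
  have sE y (u : 'cV[R]_n) : col_mx s%:M u + y *: (delta_mx j' 0 : 'cV[R]_(1 + n)) =
      col_mx s%:M (u + y *: delta_mx k 0).
    by rewrite (colE _ _ _ _ _ _ dE) scaler0 addr0.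
  apply: (IH k (fun u => f (col_mx s%:M u))).
  + exact: (continuous_pairl (p := s) (continuous_cube_slice cf)).
  + exact: (continuous_pairl (p := s) (continuous_cube_slice cfd)).
  + move=> w y; rewrite -(sE y) (_ : (fun z => _) = (fun z : R =>
      f ((col_mx s%:M w : 'cV_n.+1) + z *: delta_mx j 0))).
      exact: (df (col_mx s%:M w) y).
    by apply/funext => z; rewrite -(sE z).
  + move=> w; rewrite -[in RHS](pf (col_mx s%:M w)).
    have := sE 1 w; rewrite !scale1r => <-.
    exact: erefl.
Qed.

End CubeIntegral.

(** * Continuity of sums and products over an arbitrary topological space *)

Section ContinuousArithmetic.
Variables (K : numFieldType) (T : topologicalType).

Lemma continuous_addT (V : normedModType K) (f g : T -> V) :
  continuous f -> continuous g -> continuous (fun x => f x + g x).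
Proof. by move=> cf cg x; apply: (@cvgD _ V); [exact: cf|exact: cg]. Qed.

Lemma continuous_scaleT (V : normedModType K) (f : T -> K) (g : T -> V) :
  continuous f -> continuous g -> continuous (fun x => f x *: g x).
Proof. by move=> cf cg x; apply: (@cvgZ _ V); [exact: cf|exact: cg]. Qed.

Lemma continuous_mulT (f g : T -> K) :
  continuous f -> continuous g -> continuous (fun x => f x * g x).
Proof. by move=> cf cg x; apply: cvgM; [exact: cf|exact: cg]. Qed.

End ContinuousArithmetic.

(** * Derivatives of complex-valued functions *)

Section ComplexDerivative.
Variable R : realType.
Local Notation C := R[i].
Local Open Scope complex_scope.
Implicit Types (f g : R -> C) (x : R) (l : C).

(** The components are differentiated separately, as in [rderivable], so that the real one-variable
    rules apply to each. *)
Definition is_cderive f x l : Prop :=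
  is_derive x (1 : R) (fun s : R => complex.Re (f s)) (complex.Re l) /\
  is_derive x (1 : R) (fun s : R => complex.Im (f s)) (complex.Im l).

Lemma complex_eq (a b : C) :
  complex.Re a = complex.Re b -> complex.Im a = complex.Im b -> a = b.
Proof. by case: a b => [? ?] [? ?] /= -> ->. Qed.

Lemma ReD (a b : C) : complex.Re (a + b) = complex.Re a + complex.Re b.
Proof. by case: a b => [? ?] [? ?]. Qed.
Lemma ImD (a b : C) : complex.Im (a + b) = complex.Im a + complex.Im b.
Proof. by case: a b => [? ?] [? ?]. Qed.
Lemma ReM (a b : C) : complex.Re (a * b) =
  complex.Re a * complex.Re b - complex.Im a * complex.Im b.
Proof. by case: a b => [? ?] [? ?]. Qed.
Lemma ImM (a b : C) : complex.Im (a * b) =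
  complex.Re a * complex.Im b + complex.Im a * complex.Re b.
Proof. by case: a b => [? ?] [? ?]. Qed.
Lemma ReN (a : C) : complex.Re (- a) = - complex.Re a.
Proof. by case: a. Qed.
Lemma ImN (a : C) : complex.Im (- a) = - complex.Im a.
Proof. by case: a. Qed.
Lemma ReJ (a : C) : complex.Re (a^*)%C = complex.Re a.
Proof. by case: a. Qed.
Lemma ImJ (a : C) : complex.Im (a^*)%C = - complex.Im a.
Proof. by case: a. Qed.
Definition ReImE := (ReD, ImD, ReM, ImM, ReN, ImN, ReJ, ImJ).

Lemma is_cderive_unique f x l l' : is_cderive f x l -> is_cderive f x l' -> l = l'.
Proof.
move=> [[_ r1] [_ i1]] [[_ r2] [_ i2]]; apply: complex_eq.
  by rewrite -r1 -r2.
by rewrite -i1 -i2.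
Qed.

Lemma eq_is_cderive f h x l : f =1 h -> is_cderive f x l -> is_cderive h x l.
Proof. by move=> /funext ->. Qed.

Lemma is_derive_congr (u v : R -> R) x (a b : R) : u =1 v -> a = b ->
  is_derive x (1 : R) u a -> is_derive x (1 : R) v b.
Proof. by move=> /funext -> ->. Qed.

Lemma is_cderive_cst (c : C) x : is_cderive (fun=> c) x 0.
Proof. by split; exact: is_derive_cst. Qed.

Lemma is_cderiveD f g x a b : is_cderive f x a -> is_cderive g x b ->
  is_cderive (fun s => f s + g s) x (a + b).
Proof.
move=> [fr fi] [gr gi]; split.
  by apply: is_derive_congr (is_deriveD fr gr) => [s|]; rewrite ?fctE ReD.
by apply: is_derive_congr (is_deriveD fi gi) => [s|]; rewrite ?fctE ImD.
Qed.

Lemma is_cderiveM f g x a b : is_cderive f x a -> is_cderive g x b ->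
  is_cderive (fun s => f s * g s) x (a * g x + f x * b).
Proof.
move=> [fr fi] [gr gi]; split.
  apply: is_derive_congr (is_deriveB (is_deriveM fr gr) (is_deriveM fi gi)) => [s|].
    by rewrite ?fctE ReM.
  by rewrite !ReImE /GRing.scale/=; ring.
apply: is_derive_congr (is_deriveD (is_deriveM fr gi) (is_deriveM fi gr)) => [s|].
  by rewrite ?fctE ImM.
by rewrite !ReImE /GRing.scale/=; ring.
Qed.

Lemma is_cderive_conj f x a : is_cderive f x a ->
  is_cderive (fun s => (f s)^*%C) x (a^*)%C.
Proof.
move=> [fr fi]; split.
  by apply: is_derive_congr fr => [s|]; rewrite ReJ.
by apply: is_derive_congr (is_deriveN fi) => [s|]; rewrite ?fctE ImJ.
Qed.

Lemma is_cderive_line (c d : C) x : is_cderive (fun s => c + s%:C * d) x d.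
Proof.
have lin (a b : R) : is_derive x (1 : R) (fun s : R => a + s * b) b.
  apply: is_derive_congr (is_deriveD (is_derive_cst a x 1)
    (is_deriveM (is_derive_id x 1) (is_derive_cst b x 1))) => [s|].
    by rewrite !fctE.
  by rewrite /GRing.scale/=; ring.
split; [apply: is_derive_congr (lin (complex.Re c) (complex.Re d))|
  apply: is_derive_congr (lin (complex.Im c) (complex.Im d))] => // s;
  by rewrite !ReImE /=; ring.
Qed.

Lemma ReC (a : R) (b : C) : complex.Re (a%:C * b) = a * complex.Re b.
Proof. by case: b => ? ? /=; ring. Qed.
Lemma ImC (a : R) (b : C) : complex.Im (a%:C * b) = a * complex.Im b.
Proof. by case: b => ? ? /=; ring. Qed.

(** Meant for the logarithm of the weight, which is quadratic along every real line. *)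
Lemma is_cderive_quadratic (c d e : C) :
  is_cderive (fun s : R => c + s%:C * d + s%:C * (s%:C * e)) 0 d.
Proof.
have L := is_cderive_line c d 0.
have M := is_cderiveM (is_cderive_line 0 1 0) (is_cderive_line 0 e 0).
have := is_cderiveD L M.
rewrite [X in is_cderive _ _ X](_ : _ = d); last by rewrite rmorph0; ring.
by apply: eq_is_cderive => s; rewrite !add0r mulr1.
Qed.

Lemma is_cderive_cexp f x a : is_cderive f x a ->
  is_cderive (fun s => cexp (f s)) x (a * cexp (f x)).
Proof.
move=> [fr fi].
have e1 := is_derive1_comp (is_derive_expR (complex.Re (f x))) fr.
have c1 := is_derive1_comp (is_derive_cos (complex.Im (f x))) fi.
have s1 := is_derive1_comp (is_derive_sin (complex.Im (f x))) fi.
split.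
  apply: is_derive_congr (is_deriveM e1 c1) => [s|]; first by rewrite fctE ReC.
  by rewrite ReM ReC ImC /GRing.scale/=; ring.
apply: is_derive_congr (is_deriveM e1 s1) => [s|]; first by rewrite fctE ImC.
by rewrite ImM ReC ImC /GRing.scale/=; ring.
Qed.

Lemma is_derive_scale (f : R -> R) (a x l : R) :
  is_derive (x * a) (1 : R) f l -> is_derive x (1 : R) (fun s => f (s * a)) (l * a).
Proof.
move=> df; have lin : is_derive x (1 : R) (fun s : R => s * a) a.
  apply: is_derive_congr (is_deriveM (is_derive_id x 1) (is_derive_cst a x 1)) => [s|].
    by rewrite !fctE.
  by rewrite /GRing.scale/=; ring.
exact: (is_derive1_comp (g := fun s : R => s * a) df lin).
Qed.

Lemma is_derive_translate (f : R -> R) (a x l : R) :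
  is_derive (x - a) (1 : R) f l -> is_derive x (1 : R) (fun s => f (s - a)) l.
Proof.
move=> df; have lin : is_derive x (1 : R) (fun s : R => s - a) 1.
  apply: is_derive_congr (is_deriveB (is_derive_id x 1) (is_derive_cst a x 1)) => [s|].
    by rewrite !fctE.
  by rewrite subr0.
by rewrite -(mulr1 l); exact: (is_derive1_comp (g := fun s : R => s - a) df lin).
Qed.

Lemma is_cderive_translate f (a x : R) (l : C) :
  is_cderive f (x - a) l -> is_cderive (fun s => f (s - a)) x l.
Proof.
by move=> [dr di]; split; [apply: (is_derive_translate dr)|apply: (is_derive_translate di)].
Qed.

(** * Increments as integrals; derivatives on a diagonal and mixed derivatives *)

Lemma is_derive_cvg (f : R -> R) (x l : R) :
  h^-1 * (f (h + x) - f x) @[h --> 0^'] --> l -> is_derive x (1 : R) f l.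
Proof.
move=> H; have {}H : h^-1 *: (f (h *: (1 : R) + x) - f x) @[h --> 0^'] --> l.
  by under eq_fun do rewrite [_ *: 1]mulr1.
apply: DeriveDef; first by apply/cvg_ex; exists l.
exact: cvg_lim.
Qed.

(** The difference quotient at 0 is psi itself, so continuity of psi at 0 is enough. *)
Lemma is_derive_mul_continuous (psi : R -> R) : {for (0:R), continuous psi} ->
  is_derive (0 : R) (1 : R) (fun s => s * psi s) (psi 0).
Proof.
move=> cpsi; apply: is_derive_cvg.
apply: cvg_trans (cvg_within_filter _ cpsi).
apply: near_eq_cvg; near=> h.
have h0 : h != 0 by near: h; exact: nbhs_dnbhs_neq.
by rewrite addr0 mul0r subr0 mulKf.
Unshelve. all: by end_near. Qed.

(** Hadamard's lemma, by integrating the derivative t gd (s t) of s |-> g (s t) over [0, 1]. The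
    quotient of the increment by t becomes an integral, which extends continuously to t = 0. *)
Lemma increment_integral (g gd : R -> R) : continuous gd ->
  (forall t : R, is_derive t (1 : R) g (gd t)) ->
  forall t, g t = g 0 + t * \int[lebesgue_measure]_(s in `[0%R, 1%R]) gd (s * t).
Proof.
move=> cgd dg t.
have c1 : continuous (fun s : R => gd (s * t)).
  apply: (continuous_compT (f := fun s : R => s * t)) => //.
  by move=> s; apply: cvgM; [exact: cvg_id|exact: cvg_cst].
have := @integral01P R t (fun s => gd (s * t)) (fun=> 0) c1 (@cst_continuous _ _ 0).
rewrite integral01_cst addr0 => <-; under eq_Rintegral do rewrite addr0.
have -> : \int[lebesgue_measure]_(s in `[0%R, 1%R]) (t * gd (s * t)) =
    g (1 * t) - g (0 * t).
  apply: (@integral01_derive R (fun s => g (s * t)) (fun s => t * gd (s * t))).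
    by move=> s; apply: cvgM; [exact: cvg_cst|exact: c1].
  by move=> s; rewrite mulrC; exact: is_derive_scale.
by rewrite mul1r mul0r addrC subrK.
Qed.

(* g(s, s) = g(s, 0) + s psi(s) with psi(s) = int_0^1 g2(s, r s) dr continuous. *)
Lemma is_derive_diagonal (g g2 : R * R -> R) (l : R) : continuous g2 ->
  is_derive (0 : R) (1 : R) (fun s => g (s, 0)) l ->
  (forall s t : R, is_derive t (1 : R) (fun t => g (s, t)) (g2 (s, t))) ->
  is_derive (0 : R) (1 : R) (fun s => g (s, s)) (l + g2 (0, 0)).
Proof.
move=> cg2 d1 d2.
pose psi (s : R) := \int[lebesgue_measure]_(t in `[0%R, 1%R]) g2 (s, t * s).
have E (s : R) : g (s, s) = g (s, 0) + s * psi s.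
  have := @increment_integral (fun t => g (s, t)) (fun t => g2 (s, t)).
  by move=> /(_ (continuous_pairl cg2) (d2 s) s).
have cpsi : continuous psi.
  apply: (@continuous_integral01 R R (fun st => g2 (st.1, st.2 * st.1))).
  apply: (continuous_compT (f := fun st : R * R => (st.1, st.2 * st.1))) => //.
  apply: continuous_pairT; first exact: continuous_fst.
  by move=> x; apply: cvgM; [exact: continuous_snd|exact: continuous_fst].
have p0 : psi 0 = g2 (0, 0).
  by rewrite /psi; under eq_Rintegral do rewrite mulr0; rewrite integral01_cst.
rewrite -p0; apply: is_derive_congr (is_deriveD d1 (is_derive_mul_continuous (cpsi 0))) => //.
Qed.

(* Differentiating g(s, t) - g(s, 0) = t int_0^1 g2(s, r t) dr in s under the
   integral gives g1(0, t) - g1(0, 0) = t psi(t) with psi continuous and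
   psi(0) = g21(0, 0). *)
Lemma mixed_derive_sym (g g1 g2 g21 : R * R -> R) (l : R) :
  continuous g -> continuous g1 -> continuous g2 -> continuous g21 ->
  (forall s t : R, is_derive s (1 : R) (fun s => g (s, t)) (g1 (s, t))) ->
  (forall s t : R, is_derive t (1 : R) (fun t => g (s, t)) (g2 (s, t))) ->
  (forall s t : R, is_derive s (1 : R) (fun s => g2 (s, t)) (g21 (s, t))) ->
  is_derive (0 : R) (1 : R) (fun t => g1 (0, t)) l -> l = g21 (0, 0).
Proof.
move=> cg cg1 cg2 cg21 d1 d2 d21 d12.
pose psi (t : R) := \int[lebesgue_measure]_(r in `[0%R, 1%R]) g21 (0, r * t).
have E (t : R) : g1 (0, t) = g1 (0, 0) + t * psi t.
  have e2 (s : R) := @increment_integral (fun t => g (s, t)) (fun t => g2 (s, t))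
    (continuous_pairl cg2) (d2 s) t.
  have ct (h : R * R -> R) : continuous h -> continuous (fun sr : R * R => h (sr.1, sr.2 * t)).
    move=> ch; apply: (continuous_compT (f := fun sr : R * R => (sr.1, sr.2 * t))) => //.
    apply: continuous_pairT; first exact: continuous_fst.
    by move=> x; apply: cvgM; [exact: continuous_snd|exact: cvg_cst].
  have dl := @is_derive_integral01 R (fun sr => g2 (sr.1, sr.2 * t))
    (fun sr => g21 (sr.1, sr.2 * t)) 0 (ct _ cg2) (ct _ cg21) (fun y r => d21 y (r * t)).
  (* Both sides are values of the derivative at s = 0 of s |-> g (s, t), the second computed from
     the integral form e2; a derivative has one value. The end of the proof compares l and psi 0 in
     the same manner. *)
  have [_ <-] := d1 0 t.
  have [_ <-] : is_derive (0 : R) (1 : R) (fun s => g (s, t)) (g1 (0, 0) + t * psi t); last by [].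
  apply: is_derive_congr (is_deriveD (d1 0 0)
    (is_deriveM (is_derive_cst t (0 : R) (1 : R)) dl)) => [s|].
    by rewrite !fctE -e2.
  by rewrite /GRing.scale/= mulr0 addr0.
have cpsi : continuous psi.
  apply: (@continuous_integral01 R R (fun st => g21 (0, st.2 * st.1))).
  apply: (continuous_compT (f := fun st : R * R => (0, st.2 * st.1))) => //.
  apply: continuous_pairT; first by move=> x; exact: cvg_cst.
  by move=> x; apply: cvgM; [exact: continuous_snd|exact: continuous_fst].
have p0 : psi 0 = g21 (0, 0).
  by rewrite /psi; under eq_Rintegral do rewrite mulr0; rewrite integral01_cst.
rewrite -p0; have [_ <-] := d12.
have [_ <-] : is_derive (0 : R) (1 : R) (fun t => g1 (0, t)) (psi 0); last by [].
apply: is_derive_congr (is_deriveD (is_derive_cst (g1 (0, 0)) (0 : R) (1 : R))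
  (is_derive_mul_continuous (cpsi 0))) => [s|].
  by rewrite !fctE -E.
by rewrite add0r.
Qed.

End ComplexDerivative.

(** * Continuity of the components, the conjugation and the exponential on C *)

Section ComplexTopology.
Variable R : realType.
Local Notation C := R[i].
Local Open Scope complex_scope.

Lemma normc_ge_Im (x : C) : `|complex.Im x|%:C <= `|x|.
Proof.
case: x => a b; have := normc_ge_Re ((a +i* b) * 'i%C).
by rewrite normrM ReiNIm /= normrN [in `|'i|]normc_def /= expr0n /= expr1n add0r sqrtr1 mulr1.
Qed.

Lemma continuous_Re : continuous (fun z : C => complex.Re z).
Proof.
move=> z; apply/(@cvgrPdist_lt _ _ _ (nbhs z)) => e e0.
apply/nbhs_ballP; exists e%:C; first by rewrite /= ltcR.
move=> y /=; rewrite -ball_normE /= => zy.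
rewrite -ltcR; apply: le_lt_trans zy; rewrite -ReN -ReD.
exact: normc_ge_Re.
Qed.

Lemma continuous_Im : continuous (fun z : C => complex.Im z).
Proof.
move=> z; apply/(@cvgrPdist_lt _ _ _ (nbhs z)) => e e0.
apply/nbhs_ballP; exists e%:C; first by rewrite /= ltcR.
move=> y /=; rewrite -ball_normE /= => zy.
rewrite -ltcR; apply: le_lt_trans zy; rewrite -ImN -ImD.
exact: normc_ge_Im.
Qed.

Lemma continuous_real_complex : continuous (fun x : R => x%:C : C).
Proof.
move=> x; apply/cvgrPdist_lt => e e0.
have eE : e = (complex.Re e)%:C by apply/esym/RRe_real/ger0_real/ltW.
apply/nbhs_ballP; exists (complex.Re e); first by rewrite /= -ltcR -eE.
move=> y; rewrite /ball/= => xy.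
rewrite -rmorphB eE normc_def /= expr0n /= addr0 sqrtr_sqr ltcR.
exact: xy.
Qed.

Lemma continuous_Complex (T : topologicalType) (a b : T -> R) :
  continuous a -> continuous b -> continuous (fun x => a x +i* b x : C).
Proof.
move=> ca cb; rewrite (_ : (fun x => _) = (fun x => (a x)%:C + 'i%C * (b x)%:C)).
  move=> x; apply: cvgD; last (apply: cvgM; first exact: cvg_cst).
    by apply: (continuous_compT ca); exact: continuous_real_complex.
  by apply: (continuous_compT cb); exact: continuous_real_complex.
by apply/funext => x; rewrite [LHS]complexE.
Qed.

Lemma continuous_conjc (T : topologicalType) (f : T -> C) :
  continuous f -> continuous (fun x => ((f x)^*)%C : C).
Proof.
move=> cf; rewrite (_ : (fun x => _) = (fun x => complex.Re (f x) +i* - complex.Im (f x))).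
  apply: continuous_Complex; first exact: (continuous_compT cf continuous_Re).
  by move=> x; apply: cvgN; exact: (continuous_compT cf continuous_Im).
by apply/funext => x; case: (f x).
Qed.

Lemma continuous_cexp (T : topologicalType) (f : T -> C) :
  continuous f -> continuous (fun x => cexp (f x)).
Proof.
move=> cf x; apply: cvgM.
  apply: (@continuous_compT _ _ _ (fun x => expR (complex.Re (f x)))
    (fun r : R => r%:C)); last exact: continuous_real_complex.
  apply: (continuous_compT (continuous_compT cf continuous_Re)).
  exact: continuous_expR.
apply: continuous_Complex.
  apply: (continuous_compT (continuous_compT cf continuous_Im)).
  exact: continuous_cos.
apply: (continuous_compT (continuous_compT cf continuous_Im)).
exact: continuous_sin.
Qed.

Lemma is_cderive_cvg (f : R -> C) (x : R) (l : C) :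
  (h%:C)^-1 * (f (h + x) - f x) @[h --> 0^'] --> l -> is_cderive f x l.
Proof.
move=> H.
have inv (h : R) : (h%:C : C)^-1 = (h^-1)%:C by rewrite fmorphV.
split; apply: is_derive_cvg.
  have := cvg_comp _ _ H (@continuous_Re l).
  by apply: cvg_trans; apply: near_eq_cvg; near=> h; rewrite /= inv ReC ReD ReN.
have := cvg_comp _ _ H (@continuous_Im l).
by apply: cvg_trans; apply: near_eq_cvg; near=> h; rewrite /= inv ImC ImD ImN.
Unshelve. all: by end_near. Qed.

End ComplexTopology.

Arguments rderive : simpl never.
Arguments cexp : simpl never.

(** * Derivatives along real directions and closure properties of [Cn] *)

Section RealDirectional.
Variable R : realType.
Local Notation C := R[i].
Local Open Scope complex_scope.
Variable V : normedModType C.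
Implicit Types (f g : V -> C) (u v p : V).

Definition is_rderive f v p l := is_cderive (fun s : R => f (p + s%:C *: v)) 0 l.

Lemma is_rderiveP f v p l : is_rderive f v p l -> rderivable v f p /\ rderive v f p = l.
Proof.
move=> [[dr er] [di ei]]; split; first exact: (conj dr di).
by apply: complex_eq; rewrite /rderive /= derive1E ?er ?ei.
Qed.

Lemma rderivableP f v p : rderivable v f p -> is_rderive f v p (rderive v f p).
Proof.
move=> [dr di]; split; rewrite /rderive/= derive1E.
  exact: (derivableP dr).
exact: (derivableP di).
Qed.

Lemma rderiveE f v p l : is_rderive f v p l -> rderive v f p = l.
Proof. by case/is_rderiveP. Qed.

Lemma rderivable_line f v p (y : R) : rderivable v f (p + y%:C *: v) ->
  is_cderive (fun s : R => f (p + s%:C *: v)) y (rderive v f (p + y%:C *: v)).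
Proof.
move=> /rderivableP; set l := rderive _ _ _; rewrite /is_rderive => df.
have := @is_cderive_translate R (fun s : R => f (p + y%:C *: v + s%:C *: v)) y y l.
rewrite subrr => /(_ df).
suff -> : (fun s : R => f (p + y%:C *: v + (s - y)%:C *: v)) =
  (fun s : R => f (p + s%:C *: v)) by [].
apply/funext => s; congr f; rewrite -addrA -scalerDl; congr (_ + _ *: _).
by rewrite rmorphB addrC subrK.
Qed.

Lemma is_rderive_cst (c : C) v p : is_rderive (fun=> c) v p 0.
Proof. exact: is_cderive_cst. Qed.

Lemma is_rderiveD f g v p a b : is_rderive f v p a -> is_rderive g v p b ->
  is_rderive (fun q => f q + g q) v p (a + b).
Proof. exact: is_cderiveD. Qed.

Lemma is_rderiveM f g v p a b : is_rderive f v p a -> is_rderive g v p b ->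
  is_rderive (fun q => f q * g q) v p (a * g p + f p * b).
Proof.
move=> df dg; have := is_cderiveM df dg.
by rewrite !scale0r !addr0.
Qed.

Lemma is_rderive_conj f v p a : is_rderive f v p a ->
  is_rderive (fun q => (f q)^*%C) v p (a^*)%C.
Proof. exact: is_cderive_conj. Qed.

Lemma is_rderive_cexp f v p a : is_rderive f v p a ->
  is_rderive (fun q => cexp (f q)) v p (a * cexp (f p)).
Proof. by move=> /is_cderive_cexp; rewrite scale0r addr0. Qed.

Definition affine_along f v (d : C) := forall p (s : R), f (p + s%:C *: v) = f p + s%:C * d.

Lemma is_rderive_affine f v p d : affine_along f v d -> is_rderive f v p d.
Proof.
move=> af; rewrite /is_rderive (_ : (fun s => _) = (fun s : R => f p + s%:C * d)).
  exact: is_cderive_line.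
by apply/funext => s.
Qed.

Lemma CnW n f : Cn n.+1 f -> Cn n f.
Proof.
elim: n f => [|n IH] f; first by move=> [].
by move=> [cf df]; split=> // v; split; [case: (df v)|apply: IH; case: (df v)].
Qed.

Lemma Cn_continuous n f : Cn n f -> continuous f.
Proof. by case: n => // n []. Qed.

Lemma Cn_rderive n f v p : Cn n.+1 f -> is_rderive f v p (rderive v f p).
Proof. by move=> [_ /(_ v)[df _]]; exact: rderivableP. Qed.

Lemma CnS n f : Cn n.+1 f -> forall v, Cn n (rderive v f).
Proof. by move=> [_ df] v; case: (df v). Qed.

(** The closure properties below use this rule: the derivative is given by an explicit formula, to
    which the induction hypothesis applies. *)
Lemma Cn_SI n f (df : V -> V -> C) : continuous f ->
  (forall v p, is_rderive f v p (df v p)) -> (forall v, Cn n (df v)) -> Cn n.+1 f.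
Proof.
move=> cf Hd Hn; split=> // v; split=> [p|].
  by have [] := is_rderiveP (Hd v p).
by rewrite (_ : rderive v f = df v)//; apply/funext => p; exact: rderiveE.
Qed.

Lemma Cn_cst n (c : C) : Cn n (fun _ : V => c).
Proof.
elim: n c => [|n IH] c; first by move=> x; exact: cvg_cst.
apply: (Cn_SI (df := fun _ _ => 0)) => //; first by move=> x; exact: cvg_cst.
by move=> v p; exact: is_rderive_cst.
Qed.

Lemma CnD n f g : Cn n f -> Cn n g -> Cn n (fun q => f q + g q).
Proof.
elim: n f g => [|n IH] f g cf cg.
  by move=> x; apply: cvgD; [exact: cf|exact: cg].
apply: (Cn_SI (df := fun v p => rderive v f p + rderive v g p)).
- by move=> x; apply: cvgD; [exact: (Cn_continuous cf)|exact: (Cn_continuous cg)].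
- by move=> v p; apply: is_rderiveD; [exact: (Cn_rderive v p cf)|exact: (Cn_rderive v p cg)].
- by move=> v; apply: (IH _ _ (CnS cf v) (CnS cg v)).
Qed.

Lemma CnM n f g : Cn n f -> Cn n g -> Cn n (fun q => f q * g q).
Proof.
elim: n f g => [|n IH] f g cf cg.
  by move=> x; apply: cvgM; [exact: cf|exact: cg].
apply: (Cn_SI (df := fun v p => rderive v f p * g p + f p * rderive v g p)).
- by move=> x; apply: cvgM; [exact: (Cn_continuous cf)|exact: (Cn_continuous cg)].
- by move=> v p; apply: is_rderiveM; [exact: (Cn_rderive v p cf)|exact: (Cn_rderive v p cg)].
- by move=> v; apply: CnD; [exact: (IH _ _ (CnS cf v) (CnW cg))|exact: (IH _ _ (CnW cf) (CnS cg v))].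
Qed.

Lemma Cn_conj n f : Cn n f -> Cn n (fun q => (f q)^*%C).
Proof.
elim: n f => [|n IH] f cf; first exact: continuous_conjc.
apply: (Cn_SI (df := fun v p => (rderive v f p)^*%C)).
- exact: continuous_conjc (Cn_continuous cf).
- by move=> v p; apply: is_rderive_conj; exact: (Cn_rderive v p cf).
- by move=> v; apply: (IH _ (CnS cf v)).
Qed.

Lemma Cn_cexp n f : Cn n f -> Cn n (fun q => cexp (f q)).
Proof.
elim: n f => [|n IH] f cf; first exact: continuous_cexp.
apply: (Cn_SI (df := fun v p => rderive v f p * cexp (f p))).
- exact: continuous_cexp (Cn_continuous cf).
- by move=> v p; apply: is_rderive_cexp; exact: (Cn_rderive v p cf).
- by move=> v; apply: CnM; [exact: (CnS cf v)|exact: (IH _ (CnW cf))].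
Qed.

Lemma Cn_affine n f (d : V -> C) : continuous f ->
  (forall v, affine_along f v (d v)) -> Cn n f.
Proof.
case: n => // n cf af; apply: (Cn_SI (df := fun v _ => d v)) => //.
  by move=> v p; exact: is_rderive_affine.
by move=> v; exact: Cn_cst.
Qed.

(** * Restriction to the real plane p + s u + t v *)

Section TwoVariables.
Variables (u v p : V).

Lemma continuous_plane f : continuous f ->
  continuous (fun st : R * R => f (p + st.1%:C *: u + st.2%:C *: v)).
Proof.
move=> cf; apply: (continuous_compT (f := fun st : R * R => p + st.1%:C *: u + st.2%:C *: v)) => //.
have c1 (w : V) (h : R * R -> R) : continuous h -> continuous (fun st : R * R => (h st)%:C *: w).
  move=> ch; refine (@continuous_scaleT _ (R * R)%type V (fun st => (h st)%:C) (fun=> w) _ _).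
    exact: (continuous_compT ch (@continuous_real_complex R)).
  exact: cst_continuous.
refine (@continuous_addT _ (R * R)%type V (fun st => p + st.1%:C *: u) (fun st => st.2%:C *: v) _ _).
  refine (@continuous_addT _ (R * R)%type V (fun=> p) (fun st => st.1%:C *: u) _ _).
    exact: cst_continuous.
  by apply: c1; exact: continuous_fst.
by apply: c1; exact: continuous_snd.
Qed.

Lemma continuous_plane_Re f : continuous f ->
  continuous (fun st : R * R => complex.Re (f (p + st.1%:C *: u + st.2%:C *: v))).
Proof. by move=> cf; exact: (continuous_compT (continuous_plane cf) (@continuous_Re R)). Qed.

Lemma continuous_plane_Im f : continuous f ->
  continuous (fun st : R * R => complex.Im (f (p + st.1%:C *: u + st.2%:C *: v))).
Proof. by move=> cf; exact: (continuous_compT (continuous_plane cf) (@continuous_Im R)). Qed.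

Lemma rderivable_plane_snd f (s t : R) : (forall q, rderivable v f q) ->
  is_cderive (fun t : R => f (p + s%:C *: u + t%:C *: v)) t
    (rderive v f (p + s%:C *: u + t%:C *: v)).
Proof. by move=> df; exact: rderivable_line. Qed.

Lemma rderivable_plane_fst f (s t : R) : (forall q, rderivable u f q) ->
  is_cderive (fun s : R => f (p + s%:C *: u + t%:C *: v)) s
    (rderive u f (p + s%:C *: u + t%:C *: v)).
Proof.
move=> df; rewrite addrAC (_ : (fun s => _) = (fun s : R => f (p + t%:C *: v + s%:C *: u))).
  exact: rderivable_line.
by apply/funext => r; rewrite addrAC.
Qed.

(** The line in direction u + v is the diagonal s = t of the plane, so [is_derive_diagonal] applies
    to each component; continuity of the derivative along v is what makes the sum rule true. *)
Lemma is_rderive_dirD f : Cn 1 f ->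
  is_rderive f (u + v) p (rderive u f p + rderive v f p).
Proof.
move=> [cf df]; have [du cu] := df u; have [dv cv] := df v.
have line (s : R) : p + s%:C *: (u + v) = p + s%:C *: u + s%:C *: v.
  by rewrite scalerDr addrA.
have f0 : (fun s : R => f (p + s%:C *: u + (0 : R)%:C *: v)) = (fun s : R => f (p + s%:C *: u)).
  by apply/funext => s; rewrite scale0r addr0.
have p00 : p + (0 : R)%:C *: u + (0 : R)%:C *: v = p by rewrite !scale0r !addr0.
have [ur ui] := @rderivable_plane_fst f 0 0 du.
rewrite p00 in ur ui.
split; rewrite (ReD, ImD).
- rewrite (_ : (fun s => _) = fun s : R =>
    complex.Re (f (p + s%:C *: u + s%:C *: v))); last first.
    by apply/funext => s; rewrite line.
  have := @is_derive_diagonal R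
    (fun st => complex.Re (f (p + st.1%:C *: u + st.2%:C *: v)))
    (fun st => complex.Re (rderive v f (p + st.1%:C *: u + st.2%:C *: v))) _
    (continuous_plane_Re cv) ur.
  rewrite /= p00; apply=> s t; exact: (proj1 (rderivable_plane_snd s t dv)).
- rewrite (_ : (fun s => _) = fun s : R =>
    complex.Im (f (p + s%:C *: u + s%:C *: v))); last first.
    by apply/funext => s; rewrite line.
  have := @is_derive_diagonal R
    (fun st => complex.Im (f (p + st.1%:C *: u + st.2%:C *: v)))
    (fun st => complex.Im (rderive v f (p + st.1%:C *: u + st.2%:C *: v))) _
    (continuous_plane_Im cv) ui.
  rewrite /= p00; apply=> s t; exact: (proj2 (rderivable_plane_snd s t dv)).
Qed.

Lemma rderive_sym f : Cn 2 f -> rderive u (rderive v f) p = rderive v (rderive u f) p.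
Proof.
move=> c2; have c1 := CnW c2; have [cf df] := c1.
have [du cu] := df u; have [dv cv] := df v.
have duv : forall q, rderivable u (rderive v f) q by case: (CnS c2 v) => _ /(_ u)[].
have cuv : continuous (rderive u (rderive v f)) by case: (CnS c2 v) => _ /(_ u)[].
have dvu : forall q, rderivable v (rderive u f) q by case: (CnS c2 u) => _ /(_ v)[].
have p00 : p + (0 : R)%:C *: u + (0 : R)%:C *: v = p by rewrite !scale0r !addr0.
have [lr li] := @rderivable_plane_snd (rderive u f) 0 0 dvu.
rewrite p00 in lr li.
apply: complex_eq; apply/esym.
- rewrite -[in RHS]p00; exact: (@mixed_derive_sym R
    (fun st => complex.Re (f (p + st.1%:C *: u + st.2%:C *: v)))
    (fun st => complex.Re (rderive u f (p + st.1%:C *: u + st.2%:C *: v)))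
    (fun st => complex.Re (rderive v f (p + st.1%:C *: u + st.2%:C *: v)))
    (fun st => complex.Re (rderive u (rderive v f) (p + st.1%:C *: u + st.2%:C *: v)))
    _ (continuous_plane_Re cf) (continuous_plane_Re cu) (continuous_plane_Re cv)
    (continuous_plane_Re cuv) (fun s t => proj1 (rderivable_plane_fst s t du))
    (fun s t => proj1 (rderivable_plane_snd s t dv))
    (fun s t => proj1 (rderivable_plane_fst s t duv)) lr).
- rewrite -[in RHS]p00; exact: (@mixed_derive_sym R
    (fun st => complex.Im (f (p + st.1%:C *: u + st.2%:C *: v)))
    (fun st => complex.Im (rderive u f (p + st.1%:C *: u + st.2%:C *: v)))
    (fun st => complex.Im (rderive v f (p + st.1%:C *: u + st.2%:C *: v)))
    (fun st => complex.Im (rderive u (rderive v f) (p + st.1%:C *: u + st.2%:C *: v)))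
    _ (continuous_plane_Im cf) (continuous_plane_Im cu) (continuous_plane_Im cv)
    (continuous_plane_Im cuv) (fun s t => proj2 (rderivable_plane_fst s t du))
    (fun s t => proj2 (rderivable_plane_snd s t dv))
    (fun s t => proj2 (rderivable_plane_fst s t duv)) li).
Qed.

End TwoVariables.

Lemma rderive_dirD f u v p : Cn 1 f ->
  rderive (u + v) f p = rderive u f p + rderive v f p.
Proof. by move=> cf; apply: rderiveE; exact: is_rderive_dirD. Qed.

Lemma rderive_dir0 f p : rderive 0 f p = 0.
Proof.
apply: rderiveE; rewrite /is_rderive (_ : (fun s => _) = (fun=> f p)).
  exact: is_cderive_cst.
by apply/funext => s; rewrite scaler0 addr0.
Qed.

Lemma is_rderive_dirZ f v p (r : R) : rderivable v f p ->
  is_rderive f (r%:C *: v) p (r%:C * rderive v f p).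
Proof.
move=> /rderivableP[dr di].
have E (s : R) : p + s%:C *: (r%:C *: v) = p + (s * r)%:C *: v.
  by rewrite scalerA -rmorphM.
split.
  apply: (is_derive_congr (u := fun s => complex.Re (f (p + (s * r)%:C *: v)))
     (a := complex.Re (rderive v f p) * r)).
  - by move=> s; rewrite E.
  - by rewrite ReC mulrC.
  - by apply: (@is_derive_scale R (fun s => complex.Re (f (p + s%:C *: v))) r); rewrite mul0r.
apply: (is_derive_congr (u := fun s => complex.Im (f (p + (s * r)%:C *: v)))
   (a := complex.Im (rderive v f p) * r)).
- by move=> s; rewrite E.
- by rewrite ImC mulrC.
- by apply: (@is_derive_scale R (fun s => complex.Im (f (p + s%:C *: v))) r); rewrite mul0r.
Qed.

Lemma rderive_dirZ f v p (r : R) : rderivable v f p ->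
  rderive (r%:C *: v) f p = r%:C * rderive v f p.
Proof. by move=> df; apply: rderiveE; exact: is_rderive_dirZ. Qed.

Lemma rderive_dir_sum f p (I : Type) (r : seq I) (F : I -> V) : Cn 1 f ->
  rderive (\sum_(i <- r) F i) f p = \sum_(i <- r) rderive (F i) f p.
Proof.
move=> cf; elim: r => [|i r IH]; first by rewrite !big_nil rderive_dir0.
by rewrite !big_cons rderive_dirD// IH.
Qed.

Lemma is_rderive_translate f v p c l :
  is_rderive f v (p + c) l -> is_rderive (fun q => f (q + c)) v p l.
Proof.
rewrite /is_rderive => H; rewrite (_ : (fun s => _) =
  (fun s : R => f (p + c + s%:C *: v)))//.
by apply/funext => s; rewrite addrAC.
Qed.

End RealDirectional.

(** * Affine substitutions; complex differentiability against real derivatives *)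

Section Restriction.
Variable R : realType.
Local Notation C := R[i].
Local Open Scope complex_scope.

(** An affine substitution maps real lines to real lines, so no chain rule is involved. It serves
    for projections, for the exchange of the two variables and for the slices z |-> (xi, z). *)
Lemma Cn_comp_affine (V W : normedModType C) (L : W -> V) (dL : W -> V) :
  continuous L -> (forall w q (s : R), L (q + s%:C *: w) = L q + s%:C *: dL w) ->
  forall n f, Cn n f -> Cn n (fun q => f (L q)).
Proof.
move=> cL aL; elim=> [|n IH] f cf; first exact: (continuous_compT cL).
apply: (Cn_SI (df := fun w q => rderive (dL w) f (L q))).
- exact: (continuous_compT cL (Cn_continuous cf)).
- move=> w q; rewrite /is_rderive (_ : (fun s => _) =
    (fun s : R => f (L q + s%:C *: dL w))); first exact: (Cn_rderive _ _ cf).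
  by apply/funext => s; rewrite aL.
- by move=> w; exact: (IH _ (CnS cf _)).
Qed.

Lemma real_complex_dnbhs0 : (fun h : R => h%:C : C) @ (0 : R)^' --> (0 : C)^'.
Proof.
move=> A A0; have H : nbhs (0 : R) (fun h : R => (h%:C : C) != 0 -> A h%:C).
  exact: (@continuous_real_complex R 0 _ A0).
suff : nbhs (0 : R) (fun h : R => h != 0 -> A h%:C) by [].
apply: filterS H => h hA h0; apply: hA; apply: contra h0 => /eqP.
by move=> /complexI /eqP.
Qed.

Lemma differentiable_is_rderive (V : normedModType C) (f : V -> C) v p :
  differentiable f p -> is_rderive f v p ('d f p v).
Proof.
move=> df; apply: is_cderive_cvg.
have H : h^-1 *: (f (h *: v + p) - f p) @[h --> (0 : C)^'] --> 'd f p v.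
  have /cvg_ex[l Hl] := @diff_derivable _ _ _ f p v df.
  have -> : 'd f p v = l by rewrite -deriveE//; exact: (cvg_lim _ Hl).
  exact: Hl.
have := cvg_comp _ _ real_complex_dnbhs0 H.
apply: cvg_trans; apply: near_eq_cvg; near=> h.
by rewrite /= scale0r !addr0 [p + _]addrC.
Unshelve. all: by end_near. Qed.

Lemma normC_real (a : R) : `|a%:C : C| = `|a|%:C.
Proof. by rewrite normc_def /= expr0n /= addr0 sqrtr_sqr. Qed.

Lemma normC_i : `|'i%C : C| = 1.
Proof. by rewrite normc_def /= expr0n /= expr1n add0r sqrtr1. Qed.

Lemma continuous_sumT (T : topologicalType) (I : Type) (r : seq I) (F : I -> T -> C) :
  (forall i, continuous (F i)) -> continuous (fun x => \sum_(i <- r) F i x).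
Proof.
move=> cF; elim: r => [|i r IH].
  by under eq_fun do rewrite big_nil; exact: cst_continuous.
under eq_fun do rewrite big_cons.
by move=> x; apply: cvgD; [exact: cF|exact: IH].
Qed.

(** * Cauchy-Riemann equations *)

Section CauchyRiemann.
Variables (g : nat) (f : 'cV[C]_g -> C).
Hypotheses (f1 : Cn 1 f)
  (fCR : forall v p, rderive ('i%C *: v) f p = 'i%C * rderive v f p).

Let total p v := rderive v f p.

(** C^1 gives real linearity in the direction; [fCR] adds compatibility with i, and a complex scalar
    is split into its two components. *)
Lemma rderive_dir_linear p : linear (total p).
Proof.
move=> c u v; rewrite /total rderive_dirD//; congr (_ + _).
have df w : rderivable w f p by case: f1 => _ /(_ w)[].
rewrite {1}[c]complexE scalerDl rderive_dirD// rderive_dirZ// -scalerA fCR.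
rewrite rderive_dirZ// [RHS]/GRing.scale/= {3}[c]complexE.
by rewrite mulrDl mulrA.
Qed.

HB.instance Definition _ p := GRing.isLinear.Build C 'cV[C]_g C *:%R
  (total p) (rderive_dir_linear p).

Lemma rderive_dir_coord p v :
  rderive v f p = \sum_j v j 0 * rderive (delta_mx j 0) f p.
Proof.
pose L : {linear 'cV[C]_g -> C} := total p.
rewrite -[LHS]/(L v) {1}[v]matrix_sum_delta raddf_sum; apply: eq_bigr => j _.
by rewrite big_ord1; exact: linearZZ.
Qed.

(* By the mean value theorem on the segment from p to p + y, the increments of
   Re f and Im f are those of the differential at intermediate points, and the
   differential is complex linear at each of them. *)
Lemma Cauchy_Riemann_differentiable p : differentiable f p.
Proof.
pose L : {linear 'cV[C]_g -> C} := total p.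
have cL : continuous L.
  rewrite (_ : (L : _ -> _) = fun v => \sum_j v j 0 * rderive (delta_mx j 0) f p).
    apply: continuous_sumT => j.
    exact: (continuous_mulT (@coord_continuous _ _ _ j 0) (@cst_continuous _ _ _)).
  by apply/funext => v; exact: rderive_dir_coord.
(* As the norm on column vectors is the maximum norm, S q bounds the operator norm of the difference
   of the differentials at q and p; it is continuous and vanishes at p. *)
pose S q : C := \sum_j `|rderive (delta_mx j 0) f q - rderive (delta_mx j 0) f p|.
have cD j : continuous (rderive (delta_mx j 0) f) by case: f1 => _ /(_ (delta_mx j 0))[].
have cS : continuous S.
  apply: continuous_sumT => j.
  refine (continuous_compT (h := fun z : C => `|z|) _ (@norm_continuous _ _)).
  exact: (@continuous_addT _ _ (C : normedModType C) _ (fun=> - _) (cD j) (@cst_continuous _ _ _)).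
have S0 : S p = 0 by rewrite /S big1// => j _; rewrite subrr normr0.
have S_ge0 q : 0 <= S q by apply: sumr_ge0.
have bound q v : `|rderive v f q - rderive v f p| <= S q * `|v|.
  rewrite !(rderive_dir_coord _ v) -sumrB mulr_suml.
  apply: (le_trans (ler_norm_sum _ _ _)); apply: ler_sum => j _.
  rewrite -mulrBr normrM mulrC ler_wpM2l//.
  have -> : `|v| = (\big[Num.max/0%:nng]_i `|v i.1 i.2|%:nng)%:num by [].
  have -> : `|v j 0| = (`|v (j, 0 : 'I_1).1 (j, 0 : 'I_1).2|%:nng)%:num by [].
  rewrite num_le; exact: (@le_bigmax _ _ _ _ (fun i : 'I_g * 'I_1 => `|v i.1 i.2|%:nng) (j, 0)).
(* The expansion with a continuous linear L suffices: by [diff_unique] the differential is then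
   L. *)
suff H : f \o shift p = cst (f p) + L +o_ 0 id.
  apply/diff_locallyP; rewrite (diff_unique cL H); exact: (conj cL H).
apply/eqaddoP => e e0.
have e2 : 0 < e / 2 by rewrite divr_gt0.
have := cS p; rewrite /continuous_at S0 => /cvgrPdist_le /(_ _ e2).
move=> /nbhs_ballP[d /= d0 dS].
apply/nbhs_ballP; exists d => // y; rewrite -ball_normE /= sub0r normrN => yd.
have line (s : R) : s \in `[0, 1] -> S (p + s%:C *: y) <= e / 2.
  rewrite in_itv/= => /andP[s0 s1].
  have := dS (p + s%:C *: y); rewrite -ball_normE /= opprD addrA subrr sub0r normrN.
  rewrite sub0r normrN (ger0_norm (S_ge0 _)); apply.
  apply: le_lt_trans yd; rewrite normrZ ler_piMl//.
  by rewrite ger0_norm ?lecR// ler0c.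
have df w q : rderivable w f q by case: f1 => _ /(_ w)[].
have dc (s : R) := @rderivable_line R _ f y p s (df _ _).
have cre : {within `[0%R, 1%R], continuous (fun s : R => complex.Re (f (p + s%:C *: y)))}.
  apply: continuous_subspaceT => s; apply: differentiable_continuous.
  by apply/derivable1_diffP; have [] := proj1 (dc s).
have cim : {within `[0%R, 1%R], continuous (fun s : R => complex.Im (f (p + s%:C *: y)))}.
  apply: continuous_subspaceT => s; apply: differentiable_continuous.
  by apply/derivable1_diffP; have [] := proj2 (dc s).
(* The real and imaginary parts have different intermediate points. Both lie on the segment, where S
   is at most e / 2, and the two halves add up to e. *)
have [s1 s1I E1] := MVT_segment ler01 (fun s _ => proj1 (dc s)) cre.
have [s2 s2I E2] := MVT_segment ler01 (fun s _ => proj2 (dc s)) cim.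
rewrite scale1r scale0r addr0 subr0 !mulr1 in E1 E2.
set w := (X in `|X|).
have wE : w = f (p + y) - f p - rderive y f p.
  by rewrite /w /= !fctE /= opprD addrA [y + p]addrC.
have wR : `|complex.Re w|%:C <= e / 2 * `|y|.
  have -> : complex.Re w =
      complex.Re (rderive y f (p + s1%:C *: y) - rderive y f p).
    by rewrite wE !ReD !ReN E1.
  apply: (le_trans (normc_ge_Re _)); apply: (le_trans (bound _ _)).
  by rewrite ler_wpM2r// line.
have wI : `|complex.Im w|%:C <= e / 2 * `|y|.
  have -> : complex.Im w =
      complex.Im (rderive y f (p + s2%:C *: y) - rderive y f p).
    by rewrite wE !ImD !ImN E2 ?mulr1.
  apply: (le_trans (normc_ge_Im _)); apply: (le_trans (bound _ _)).
  by rewrite ler_wpM2r// line.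
clearbody w; rewrite [w]complexE.
apply: (le_trans (ler_normD _ _)); rewrite [e]splitr mulrDl; apply: lerD.
  by rewrite normC_real.
by rewrite normrM normC_i mul1r normC_real.
Qed.

End CauchyRiemann.
End Restriction.

(** * Complex-valued integrals over the cube *)

Section ComplexCubeIntegral.
Variable R : realType.
Local Notation C := R[i].
Local Open Scope complex_scope.

Lemma cube_integralZ n (a : R) (f : 'cV[R]_n -> R) : continuous f ->
  cube_integral (fun w => a * f w) = a * cube_integral f.
Proof.
move=> cf; have := @cube_integralP R n a f (fun=> 0) cf (@cst_continuous _ _ 0).
by rewrite cube_integral_cst addr0; under eq_fun do rewrite addr0.
Qed.

Lemma continuous_ReT (T : topologicalType) (f : T -> C) : continuous f ->
  continuous (fun x => complex.Re (f x)).
Proof. by move=> cf; exact: (continuous_compT cf (@continuous_Re R)). Qed.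

Lemma continuous_ImT (T : topologicalType) (f : T -> C) : continuous f ->
  continuous (fun x => complex.Im (f x)).
Proof. by move=> cf; exact: (continuous_compT cf (@continuous_Im R)). Qed.

Lemma cube_cintegralP n (c : C) (f h : 'cV[R]_n -> C) :
  continuous f -> continuous h ->
  cube_cintegral (fun w => c * f w + h w) = c * cube_cintegral f + cube_cintegral h.
Proof.
move=> cf ch; have [crf cif] := (continuous_ReT cf, continuous_ImT cf).
have [crh cih] := (continuous_ReT ch, continuous_ImT ch).
have cM (a : R) (u : 'cV[R]_n -> R) : continuous u -> continuous (fun w => a * u w).
  by move=> cu; exact: (continuous_mulT (@cst_continuous _ _ a) cu).
have cD (u v : 'cV[R]_n -> R) : continuous u -> continuous v -> continuous (fun w => u w + v w).
  by move=> cu cv; exact: (@continuous_addT R _ R _ _ cu cv).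
apply: complex_eq; rewrite !ReImE /cube_cintegral /=.
  transitivity (cube_integral (fun w => complex.Re c * complex.Re (f w) +
      (- complex.Im c * complex.Im (f w) + complex.Re (h w)))).
    by congr cube_integral; apply/funext => w; rewrite ReD ReM; ring.
  rewrite cube_integralP//; last by apply: cD => //; exact: cM.
  by rewrite cube_integralP//; ring.
transitivity (cube_integral (fun w => complex.Re c * complex.Im (f w) +
    (complex.Im c * complex.Re (f w) + complex.Im (h w)))).
  by congr cube_integral; apply/funext => w; rewrite ImD ImM; ring.
rewrite cube_integralP//; last by apply: cD => //; exact: cM.
by rewrite cube_integralP//; ring.
Qed.

Lemma cube_cintegral0 n : cube_cintegral (fun _ : 'cV[R]_n => 0 : C) = 0.
Proof. by rewrite /cube_cintegral /= !cube_integral_cst. Qed.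

Lemma cube_cintegralZ n (c : C) (f : 'cV[R]_n -> C) : continuous f ->
  cube_cintegral (fun w => c * f w) = c * cube_cintegral f.
Proof.
move=> cf; have := @cube_cintegralP n c f (fun=> 0) cf (@cst_continuous _ _ 0).
by rewrite cube_cintegral0 addr0; under eq_fun do rewrite addr0.
Qed.

Lemma cube_cintegralD n (f h : 'cV[R]_n -> C) : continuous f -> continuous h ->
  cube_cintegral (fun w => f w + h w) = cube_cintegral f + cube_cintegral h.
Proof.
move=> cf ch; have := @cube_cintegralP n 1 f h cf ch; rewrite mul1r => <-.
by under [in RHS]eq_fun do rewrite mul1r.
Qed.

Lemma cube_cintegral_conj n (f : 'cV[R]_n -> C) : continuous f ->
  cube_cintegral (fun w => (f w)^*%C) = (cube_cintegral f)^*%C.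
Proof.
move=> cf; apply: complex_eq; rewrite ?(ReJ, ImJ) /cube_cintegral /=.
  by congr cube_integral; apply/funext => w; rewrite ReJ.
rewrite -mulN1r -cube_integralZ; last exact: continuous_ImT.
by congr cube_integral; apply/funext => w; rewrite ImJ mulN1r.
Qed.

Lemma continuous_cube_cintegral (P : topologicalType) n (F : P * 'cV[R]_n -> C) :
  continuous F -> continuous (fun p => cube_cintegral (fun w => F (p, w))).
Proof.
move=> cF; apply: continuous_Complex.
  exact: (continuous_cube_integral (continuous_ReT cF)).
exact: (continuous_cube_integral (continuous_ImT cF)).
Qed.

Lemma is_cderive_cube_cintegral n (f fd : R * 'cV[R]_n -> C) (x : R) :
  continuous f -> continuous fd ->
  (forall (y : R) w, is_cderive (fun y : R => f (y, w)) y (fd (y, w))) ->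
  is_cderive (fun y : R => cube_cintegral (fun w => f (y, w))) x
    (cube_cintegral (fun w => fd (x, w))).
Proof.
move=> cf cfd df; split.
  exact: (is_derive_cube_integral (f := fun yw => complex.Re (f yw))
    (fd := fun yw => complex.Re (fd yw)) x
    (continuous_ReT cf) (continuous_ReT cfd) (fun y w => proj1 (df y w))).
exact: (is_derive_cube_integral (f := fun yw => complex.Im (f yw))
  (fd := fun yw => complex.Im (fd yw)) x
  (continuous_ImT cf) (continuous_ImT cfd) (fun y w => proj2 (df y w))).
Qed.

Lemma cube_cintegral_derive_periodic n (j : 'I_n) (f fd : 'cV[R]_n -> C) :
  continuous f -> continuous fd ->
  (forall w (y : R), is_cderive (fun s : R => f (w + s *: delta_mx j 0)) y
     (fd (w + y *: delta_mx j 0))) ->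
  (forall w, f (w + delta_mx j 0) = f w) ->
  cube_cintegral fd = 0.
Proof.
move=> cf cfd df pf; apply: complex_eq.
  exact: (@cube_integral_derive_periodic R n j (fun w => complex.Re (f w))
    (fun w => complex.Re (fd w)) (continuous_ReT cf) (continuous_ReT cfd)
    (fun w y => proj1 (df w y)) (fun w => congr1 _ (pf w))).
exact: (@cube_integral_derive_periodic R n j (fun w => complex.Im (f w))
  (fun w => complex.Im (fd w)) (continuous_ImT cf) (continuous_ImT cfd)
  (fun w y => proj2 (df w y)) (fun w => congr1 _ (pf w))).
Qed.

End ComplexCubeIntegral.

(** * Integration over the fibre torus *)

Section FibreIntegral.
Variables (R : realType) (g : nat) (tau : R[i]).
Local Notation C := R[i].
Local Notation CV := 'cV[C]_g.
Local Open Scope complex_scope.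
Local Notation ofZ l := (map_mx intr l : CV).
Local Notation ofR x := (map_mx (fun r : R => r%:C) x : CV).

Definition torus_point (w : 'cV[R]_(g + g)) : CV :=
  ofR (usubmx w) + tau *: ofR (dsubmx w).

Lemma torus_point_affine w e (s : R) :
  torus_point (w + s *: e) = torus_point w + s%:C *: torus_point e.
Proof.
apply/matrixP => i j; rewrite !mxE !rmorphD !rmorphM /=; ring.
Qed.

Lemma torus_point_sum w :
  torus_point w = \sum_k (w k 0)%:C *: torus_point (delta_mx k 0).
Proof.
rewrite {1}[w]matrix_sum_delta; elim/big_rec2: _ => [|k y1 y2 _ <-].
  by apply/matrixP => i j; rewrite !mxE rmorph0 mulr0 addr0.
by rewrite big_ord1 addrC torus_point_affine addrC.
Qed.

Lemma continuous_torus_point : continuous torus_point.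
Proof.
apply: continuous_mx => i j.
have c k : continuous (fun w : 'cV[R]_(g + g) => (w k j)%:C).
  exact: (continuous_compT (@coord_continuous _ _ _ k j) (@continuous_real_complex R)).
rewrite (_ : (fun x => _) = (fun w : 'cV[R]_(g + g) =>
    (w (lshift g i) j)%:C + tau * (w (rshift g i) j)%:C)); last first.
  by apply/funext => w; rewrite !mxE.
exact: (@continuous_addT C _ C _ _ (c _) (continuous_mulT (@cst_continuous _ _ tau) (c _))).
Qed.

(** The integrand lives on the product, so that a single directional derivative can move the base
    point and the fibre point together. *)
Definition fibre_integral (S : CV * CV -> C) (xi : CV) : C :=
  cube_cintegral (fun w => S (xi, torus_point w)).

Lemma continuous_fibre (T : topologicalType) (S : CV * CV -> C) (h : T -> CV) :
  continuous S -> continuous h ->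
  continuous (fun pw : T * 'cV[R]_(g + g) => S (h pw.1, torus_point pw.2)).
Proof.
move=> cS ch; apply: (continuous_compT (f := fun pw : T * 'cV[R]_(g + g) =>
  (h pw.1, torus_point pw.2))) => //.
apply: continuous_pairT.
  exact: (continuous_compT (@continuous_fst _ _) ch).
exact: (continuous_compT (@continuous_snd _ _) continuous_torus_point).
Qed.

Lemma continuous_fibre1 (S : CV * CV -> C) xi : continuous S ->
  continuous (fun w => S (xi, torus_point w)).
Proof.
move=> cS; exact: (continuous_compT continuous_torus_point (continuous_pairl cS)).
Qed.

Lemma fibre_integralD (S T : CV * CV -> C) xi : continuous S -> continuous T ->
  fibre_integral (fun p => S p + T p) xi = fibre_integral S xi + fibre_integral T xi.
Proof. by move=> cS cT; apply: cube_cintegralD; exact: continuous_fibre1. Qed.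

Lemma fibre_integralZ (c : C) (S : CV * CV -> C) xi : continuous S ->
  fibre_integral (fun p => c * S p) xi = c * fibre_integral S xi.
Proof. by move=> cS; apply: cube_cintegralZ; exact: continuous_fibre1. Qed.

Lemma fibre_integral_sum (I : Type) (r : seq I) (F : I -> CV * CV -> C) xi :
  (forall i, continuous (F i)) ->
  fibre_integral (fun p => \sum_(i <- r) F i p) xi = \sum_(i <- r) fibre_integral (F i) xi.
Proof.
move=> cF; elim: r => [|i r IH].
  rewrite big_nil -[RHS](@cube_cintegral0 R (g + g)) /fibre_integral.
  by congr cube_cintegral; apply/funext => w; rewrite big_nil.
rewrite big_cons -IH -fibre_integralD//; last exact: continuous_sumT.
by congr cube_cintegral; apply/funext => w; rewrite big_cons.
Qed.

Lemma is_rderive_fibre_integral (S : CV * CV -> C) v xi : Cn 1 S ->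
  is_rderive (fibre_integral S) v xi (fibre_integral (rderive (v, 0) S) xi).
Proof.
move=> [cS /(_ (v, 0))[dS cdS]].
have cl : continuous (fun s : R => xi + s%:C *: v).
  refine (@continuous_addT C R CV (fun=> xi) (fun s => s%:C *: v) (@cst_continuous _ _ _) _).
  exact: (@continuous_scaleT C R CV (fun s => s%:C) (fun=> v)
    (@continuous_real_complex R) (@cst_continuous _ _ _)).
have := @is_cderive_cube_cintegral R (g + g)
  (fun sw => S (xi + sw.1%:C *: v, torus_point sw.2))
  (fun sw => rderive (v, 0) S (xi + sw.1%:C *: v, torus_point sw.2)) 0
  (continuous_fibre cS cl) (continuous_fibre cdS cl).
rewrite /= scale0r addr0; apply => y w.
have E (s : R) : (xi + s%:C *: v, torus_point w) =
    (xi, torus_point w) + s%:C *: ((v, 0) : CV * CV).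
  by congr pair; rewrite /= scaler0 addr0.
have := @rderivable_line R _ S (v, 0) (xi, torus_point w) y (dS _).
by rewrite -E; apply: eq_is_cderive => s; exact: (congr1 S (esym (E s))).
Qed.

Lemma Cn_fibre_integral n (S : CV * CV -> C) : Cn n S -> Cn n (fibre_integral S).
Proof.
elim: n S => [|n IH] S cS.
  by apply: (continuous_cube_cintegral (continuous_fibre cS (fun=> cvg_id))).
apply: (Cn_SI (df := fun v => fibre_integral (rderive (v, 0) S))).
- by apply: (continuous_cube_cintegral
    (continuous_fibre (Cn_continuous cS) (fun=> cvg_id))).
- move=> v p; apply: is_rderive_fibre_integral.
  by elim: n cS {IH} => // n IH cS; apply: IH; exact: CnW.
- by move=> v; apply: IH; exact: (CnS cS).
Qed.

Hypothesis tau_gt0 : 0 < complex.Im tau.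

Lemma torus_point_surj (u : CV) : exists w, torus_point w = u.
Proof.
pose y := tau_coord tau u.
pose x : 'cV[R]_g := \col_j (complex.Re (u j 0) - complex.Re tau * y j 0).
exists (col_mx x y); rewrite /torus_point col_mxKu col_mxKd.
apply/matrixP => i j; rewrite !ord1 !mxE.
have t0 : complex.Im tau != 0 by rewrite gt_eqF.
apply: complex_eq; rewrite !ReImE /=; first by ring.
by field.
Qed.

Lemma tau_coord_torus_point w : tau_coord tau (torus_point w) = dsubmx w.
Proof.
have t0 : complex.Im tau != 0 by rewrite gt_eqF.
apply/matrixP => i j; rewrite !ord1 !mxE !ReImE /=.
by field.
Qed.

(** The direction u is a real combination of the 2 g generators of the lattice, the images of the
    unit vectors under [torus_point]. Along each generator the integrand is a periodic function of
    one cube coordinate, so its derivative has integral 0. *)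
Lemma fibre_integral_derive_periodic (S : CV * CV -> C) u xi : Cn 1 S ->
  (forall (l : 'cV[int]_g) z, S (xi, z + ofZ l) = S (xi, z)) ->
  (forall (l : 'cV[int]_g) z, S (xi, z + tau *: ofZ l) = S (xi, z)) ->
  fibre_integral (rderive (0, u) S) xi = 0.
Proof.
move=> cS p1 p2; have [w <-] := torus_point_surj u.
have [cS0 dS] := cS.
pose e k : 'cV[R]_(g + g) := delta_mx k 0.
have -> : rderive (0, torus_point w) S =
    (fun p => \sum_k (w k 0)%:C * rderive (0, torus_point (e k)) S p).
  apply/funext => p.
  have -> : (0, torus_point w) = \sum_k (w k 0)%:C *: ((0, torus_point (e k)) : CV * CV).
    transitivity ((0, \sum_k (w k 0)%:C *: torus_point (e k)) : CV * CV).
      by congr pair; exact: torus_point_sum.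
    elim/big_rec2: _ => [//|k y1 y2 _ <-]; congr pair.
    by rewrite /= scaler0 add0r.
  rewrite rderive_dir_sum//; apply: eq_bigr => k _.
  by rewrite rderive_dirZ//; case: (dS (0, torus_point (e k))).
pose F k p := (w k 0)%:C * rderive (0, torus_point (e k)) S p.
have cF k : continuous (F k).
  have [_ ck] := dS (0, torus_point (e k)).
  exact: (continuous_mulT (@cst_continuous _ _ _) ck).
rewrite (@fibre_integral_sum _ _ F xi cF) /F; apply: big1 => k _.
  have [dk ck] := dS (0, torus_point (e k)).
  rewrite fibre_integralZ//.
  suff -> : fibre_integral (rderive (0, torus_point (e k)) S) xi = 0 by rewrite mulr0.
  have D w' (y : R) : is_cderive (fun s : R => S (xi, torus_point (w' + s *: delta_mx k 0))) y
      (rderive (0, torus_point (e k)) S (xi, torus_point (w' + y *: delta_mx k 0))).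
    have E (s : R) : (xi, torus_point (w' + s *: delta_mx k 0)) =
        (xi, torus_point w') + s%:C *: ((0, torus_point (e k)) : CV * CV).
      by congr pair; rewrite /= ?scaler0 ?addr0// torus_point_affine.
    have := @rderivable_line R _ S (0, torus_point (e k)) (xi, torus_point w') y (dk _).
    by rewrite -E; apply: eq_is_cderive => s; exact: (congr1 S (esym (E s))).
  have P w' : S (xi, torus_point (w' + delta_mx k 0)) = S (xi, torus_point w').
    rewrite -[delta_mx k 0]scale1r torus_point_affine scale1r.
    (* A unit vector of the cube goes to a lattice vector: one of the two summands is 0, the other
       is a generator. *)
    have -> : torus_point (delta_mx k 0) =
        ofZ (usubmx (delta_mx k 0 : 'cV[int]_(g + g))) +
        tau *: ofZ (dsubmx (delta_mx k 0 : 'cV[int]_(g + g))).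
      by apply/matrixP => i j; rewrite !mxE !rmorph_nat.
    by rewrite addrA p2 p1.
  rewrite /fibre_integral.
  exact: (@cube_cintegral_derive_periodic R (g + g) k (fun w => S (xi, torus_point w))
    (fun w => rderive (0, torus_point (e k)) S (xi, torus_point w))
    (continuous_fibre1 cS0) (continuous_fibre1 ck) D P).
Qed.

End FibreIntegral.

(** * Bilinearity of [dotv] *)

Section Dotv.
Variables (A : comNzRingType) (g : nat).
Implicit Types (u v w : 'cV[A]_g).

Lemma dotvE u v : dotv u v = \sum_j u j 0 * v j 0.
Proof. by rewrite /dotv mxE; apply: eq_bigr => j _; rewrite mxE. Qed.

Lemma dotvC u v : dotv u v = dotv v u.
Proof. by rewrite !dotvE; apply: eq_bigr => j _; rewrite mulrC. Qed.

Lemma dotvDr u v w : dotv u (v + w) = dotv u v + dotv u w.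
Proof. by rewrite /dotv mulmxDr mxE. Qed.

Lemma dotvDl u v w : dotv (u + v) w = dotv u w + dotv v w.
Proof. by rewrite !(dotvC _ w) dotvDr. Qed.

Lemma dotvZr (a : A) u v : dotv u (a *: v) = a * dotv u v.
Proof. by rewrite /dotv -scalemxAr mxE. Qed.

Lemma dotvZl (a : A) u v : dotv (a *: u) v = a * dotv u v.
Proof. by rewrite !(dotvC _ v) dotvZr. Qed.

Lemma dotvNr u v : dotv u (- v) = - dotv u v.
Proof. by rewrite -scaleN1r dotvZr mulN1r. Qed.

Lemma dotvNl u v : dotv (- u) v = - dotv u v.
Proof. by rewrite -scaleN1r dotvZl mulN1r. Qed.

Lemma dotv_mulmx (M : 'M[A]_g) u v : dotv u (M *m v) = dotv v (M^T *m u).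
Proof. by rewrite dotvC /dotv trmx_mul -mulmxA. Qed.

End Dotv.

(** * The complex exponential *)

Section CexpTheory.
Variable R : realType.
Local Notation C := R[i].
Local Open Scope complex_scope.

Lemma cexpD (a b : C) : cexp (a + b) = cexp a * cexp b.
Proof.
apply: complex_eq; rewrite /cexp !(ReD, ImD) expRD ?(cosD, sinD) !ReImE /=; ring.
Qed.

Lemma cexp0 : cexp (0 : C) = 1.
Proof. by rewrite /cexp /= expR0 cos0 sin0; apply: complex_eq; rewrite !ReImE /=; ring. Qed.

Lemma cexp_conj (a : C) : (cexp a)^*%C = cexp (a^*)%C.
Proof.
apply: complex_eq; rewrite ?(ReJ, ImJ) /cexp ReJ ImJ cosN sinN !ReImE /=; ring.
Qed.

Lemma cexp_real (r : R) : cexp (r%:C) = (expR r)%:C.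
Proof. by rewrite /cexp /= cos0 sin0; apply: complex_eq; rewrite !ReImE /=; ring. Qed.

End CexpTheory.

Lemma differentiable_rderive_i (R : realType) (V : normedModType R[i]) (f : V -> R[i]) v p :
  differentiable f p -> rderive ('i%C *: v) f p = 'i%C * rderive v f p.
Proof.
move=> df; rewrite !(rderiveE (differentiable_is_rderive _ df)).
exact: linearZZ.
Qed.

Lemma holomorphic_linear (R : realType) (V : normedModType R[i]) (c : R[i])
    (f1 f2 : V -> R[i]) :
  holomorphic f1 -> holomorphic f2 -> holomorphic (fun z => c * f1 z + f2 z).
Proof.
by move=> h1 h2 z; exact: (differentiableD (differentiableZ c (h1 z)) (h2 z)).
Qed.

Lemma Cn_sum (R : realType) (V : normedModType R[i]) n (I : Type) (r : seq I) (F : I -> V -> R[i]) :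
  (forall i, Cn n (F i)) -> Cn n (fun p => \sum_(i <- r) F i p).
Proof.
move=> cF; elim: r => [|i r IH].
  by under eq_fun do rewrite big_nil; exact: Cn_cst.
by under eq_fun do rewrite big_cons; exact: CnD.
Qed.

(** * The bundle, its metric and its connection *)

Opaque cexp rderive.

Section Bundle.
Variables (R : realType) (g : nat) (tau : R[i]) (K : 'M[int]_g).
Hypotheses (tau_gt0 : 0 < complex.Im tau) (K_sym : K^T = K) (K_posdef : posdef R K).
Local Open Scope complex_scope.
Local Notation C := R[i].
Local Notation CV := 'cV[C]_g.
Local Notation KC := (map_mx intr K : 'M[C]_g).
Local Notation KR := (map_mx intr K : 'M[R]_g).
Local Notation ofZ l := (map_mx intr l : CV).
Local Notation ofR x := (map_mx (fun r : R => r%:C) x : CV).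
Local Notation piC := ((pi : R)%:C).
Local Notation t := (complex.Im tau).

(** * Inverting K; tau-coordinates and the lattice *)

Lemma tau_neq0 : t != 0. Proof. by rewrite gt_eqF. Qed.

Lemma KR_unit : KR \in unitmx.
Proof.
rewrite unitmxE unitfE; apply/negP => /det0P[v v0 vK].
have := K_posdef (x := v^T); rewrite /dotv trmxK mulmxA vK mul0mx mxE ltxx.
by case/(_ _)/notF; apply: contra v0 => /eqP h; rewrite -[v]trmxK h trmx0.
Qed.

Lemma KC_KR : KC = map_mx (real_complex R) KR.
Proof. by apply/matrixP => i j; rewrite !mxE rmorph_int. Qed.

Lemma KC_unit : KC \in unitmx.
Proof.
by rewrite KC_KR unitmxE det_map_mx unitfE fmorph_eq0 -unitfE -unitmxE KR_unit.
Qed.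

Lemma KR_sym : KR^T = KR.
Proof. by rewrite map_trmx K_sym. Qed.

Definition Kinv (v : CV) : CV := invmx KC *m v.

Lemma mulKC_Kinv v : KC *m Kinv v = v.
Proof. by rewrite /Kinv mulmxA mulmxV ?KC_unit// mul1mx. Qed.

Lemma KinvD u v : Kinv (u + v) = Kinv u + Kinv v.
Proof. exact: mulmxDr. Qed.

Lemma KinvZ c v : Kinv (c *: v) = c *: Kinv v.
Proof. by rewrite /Kinv -scalemxAr. Qed.

Local Notation y := (tau_coord tau).

Lemma tau_coord_affine (p v : CV) (s : R) : y (p + s%:C *: v) = y p + s *: y v.
Proof. by apply/matrixP => i j; rewrite !mxE ImD ImC mulrDl mulrA. Qed.

Lemma tau_coordD (u v : CV) : y (u + v) = y u + y v.
Proof. by apply/matrixP => i j; rewrite !mxE ImD mulrDl. Qed.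

Lemma tau_coordN (v : CV) : y (- v) = - y v.
Proof. by apply/matrixP => i j; rewrite !mxE ImN mulNr. Qed.

Lemma tau_coordZ (r : R) (v : CV) : y (r%:C *: v) = r *: y v.
Proof. by apply/matrixP => i j; rewrite !mxE ImC mulrA. Qed.

Lemma Im_intr (n : int) : complex.Im (n%:~R : C) = 0.
Proof. by rewrite -(rmorph_int (real_complex R)). Qed.

Lemma Re_intr (n : int) : complex.Re (n%:~R : C) = n%:~R.
Proof. by rewrite -(rmorph_int (real_complex R)). Qed.

Lemma tau_coord_ofZ (l : 'cV[int]_g) : y (ofZ l) = 0.
Proof. by apply/matrixP => i j; rewrite !mxE Im_intr mul0r. Qed.

Lemma tau_coord_tau_ofZ (l : 'cV[int]_g) : y (tau *: ofZ l) = map_mx intr l.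
Proof.
apply/matrixP => i j; rewrite !ord1 !mxE ImM Im_intr Re_intr mulr0 add0r mulrC.
by rewrite mulKf// tau_neq0.
Qed.

Lemma tau_coord_KC (v : CV) : y (KC *m v) = KR *m y v.
Proof.
apply/matrixP => i j; rewrite !ord1 !mxE (big_morph (@complex.Im R) (@ImD R) erefl).
rewrite mulr_suml; apply: eq_bigr => k _.
by rewrite !mxE ImM Im_intr Re_intr mul0r addr0 mulrA.
Qed.

Lemma Im_dotv_ofR (a : 'cV[R]_g) u : complex.Im (dotv (ofR a) u) = t * dotv a (y u).
Proof.
rewrite !dotvE (big_morph (@complex.Im R) (@ImD R) erefl) mulr_sumr.
apply: eq_bigr => j _; rewrite !mxE ImC mulrCA; congr (_ * _).
by rewrite mulrC divfK// tau_neq0.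
Qed.

(** The exponent in [Wprod], extended from the cube to all (xi, z) by reading y and a as the
    tau-coordinates of z and xi. It can then be differentiated in every direction and compared at
    lattice translates. *)
Definition log_weight (p : CV * CV) : R :=
  - 2 * pi * t * dotv (y p.2) (KR *m y p.2 + 2 *: y p.1).

(** Stated with [cexp] so that it combines with the automorphy factors by [cexpD] and is smooth by
    [Cn_cexp]. *)
Definition weight (p : CV * CV) : C := cexp (log_weight p)%:C.

Lemma Cn_tau_coord_fst n j : Cn n (fun p : CV * CV => (y p.1 j 0)%:C).
Proof.
have := @Cn_comp_affine R CV (CV * CV)%type fst fst (@continuous_fst _ _).
move=> /(_ (fun _ _ _ => erefl) n (fun z => (y z j 0)%:C)); apply.
apply: (@Cn_affine R CV n _ (fun v => (y v j 0)%:C)).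
  rewrite (_ : (fun z => _) = (fun z : CV => (complex.Im (z j 0) / t)%:C)); last first.
    by apply/funext => z; rewrite mxE.
  refine (continuous_compT (h := fun r : R => r%:C : C) _ (@continuous_real_complex R)).
  exact: (continuous_mulT (continuous_ImT (@coord_continuous _ _ _ j 0)) (@cst_continuous _ _ _)).
move=> v p s /=; rewrite -rmorphM -rmorphD; congr (_%:C).
by rewrite !mxE ImD ImC mulrDl mulrA.
Qed.

Lemma Cn_tau_coord_snd n j : Cn n (fun p : CV * CV => (y p.2 j 0)%:C).
Proof.
have := @Cn_comp_affine R (CV * CV)%type (CV * CV)%type (fun p => (p.2, p.1))
  (fun p => (p.2, p.1)).
move=> /(_ (continuous_pairT (@continuous_snd _ _) (@continuous_fst _ _))).
by move=> /(_ (fun _ _ _ => erefl) n _ (Cn_tau_coord_fst n j)).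
Qed.

Lemma Cn_weight n : Cn n weight.
Proof.
apply: Cn_cexp.
rewrite (_ : (fun q => _) = (fun p : CV * CV => (- 2 * pi * t)%:C *
  \sum_j (y p.2 j 0)%:C * (\sum_k (KR j k)%:C * (y p.2 k 0)%:C + 2 * (y p.1 j 0)%:C))).
  apply: CnM; first exact: Cn_cst.
  apply: Cn_sum => j; apply: CnM; first exact: Cn_tau_coord_snd.
  apply: CnD; last by apply: CnM; [exact: Cn_cst|exact: Cn_tau_coord_fst].
  by apply: Cn_sum => k; apply: CnM; [exact: Cn_cst|exact: Cn_tau_coord_snd].
apply/funext => p; rewrite /log_weight dotvE rmorphM; congr (_ * _).
rewrite rmorph_sum; apply: eq_bigr => j _; rewrite rmorphM; congr (_ * _).
rewrite 2!mxE rmorphD rmorph_sum; congr (_ + _).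
  by apply: eq_bigr => k _; rewrite rmorphM.
by rewrite mxE rmorphM rmorph_nat.
Qed.

(* The (1,0)-part of d(2 pi t a^t K^-1 a) for xi = tau a + b. *)
Definition connection_coef (v xi : CV) : C :=
  - (2 * piC * 'i%C) * dotv (ofR (y xi)) (Kinv v).

(** The direction in which xi + K z does not change, hence tangent to the curves of constant
    automorphy exponent in z. *)
Definition horizontal (v : CV) : CV * CV := (v, - Kinv v).

(* This pointwise identity is what makes the connection metric. *)
Lemma is_rderive_log_weight v p : is_rderive (fun q => (log_weight q)%:C) (horizontal v) p
  (connection_coef v p.1 + (connection_coef v p.1)^*%C).
Proof.
set k := y (Kinv v).
have Kk : KR *m k = y v by rewrite -tau_coord_KC mulKC_Kinv.
have -> : connection_coef v p.1 + (connection_coef v p.1)^*%C =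
    (4 * pi * t * dotv k (y p.1))%:C.
  rewrite addcJ /connection_coef; set D := dotv _ _.
  have DI : complex.Im D = t * dotv (y p.1) k by rewrite Im_dotv_ofR.
  apply: complex_eq; rewrite (dotvC k) !ReImE /= DI; ring.
rewrite /is_rderive.
(* For k = y (Kinv v), the step s moves y (z) by -s k and y (xi) by s K k. The terms of first order
   in s that contain y (z) cancel by symmetry of K; what remains is -2 s k^t a - s^2 k^t K k, times
   -2 pi t. *)
have := is_cderive_quadratic (log_weight p)%:C (4 * pi * t * dotv k (y p.1))%:C
   (2 * pi * t * dotv k (KR *m k))%:C.
apply: eq_is_cderive => s; rewrite -!rmorphM -!rmorphD; congr (_%:C).
rewrite /log_weight /= !tau_coord_affine tau_coordN -/k -Kk.
rewrite scalerN mulmxBr -scalemxAr.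
rewrite !(dotvDl, dotvDr, dotvNl, dotvNr, dotvZl, dotvZr).
rewrite (dotv_mulmx _ k (y p.2)) KR_sym.
ring.
Qed.

Lemma weight_real p : weight p = (expR (log_weight p))%:C.
Proof. exact: cexp_real. Qed.

(** * The integrand of the metric and its periods *)

Definition integrand (Phi Psi : CV -> CV -> C) (p : CV * CV) : C :=
  weight p * (Phi p.1 p.2 * (Psi p.1 p.2)^*%C).

Lemma Wprod_integrand xi H1 H2 : Wprod tau K xi H1 H2 =
  fibre_integral tau (integrand (fun=> H1) (fun=> H2)) xi.
Proof.
congr cube_cintegral; apply/funext => w.
rewrite /integrand weight_real /log_weight /= tau_coord_torus_point//.
Qed.

Lemma h_cE Phi Psi xi : h_c tau K Phi Psi xi = fibre_integral tau (integrand Phi Psi) xi.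
Proof. by rewrite /h_c Wprod_integrand. Qed.

Definition uncurried (Phi : CV -> CV -> C) (p : CV * CV) : C := Phi p.1 p.2.

Lemma continuous_integrand (Phi Psi : CV -> CV -> C) :
  continuous (uncurried Phi) -> continuous (uncurried Psi) -> continuous (integrand Phi Psi).
Proof.
move=> cP cQ; apply: (continuous_mulT (Cn_continuous (Cn_weight 0))).
exact: (continuous_mulT cP (continuous_conjc cQ)).
Qed.

Lemma Cn_integrand n (Phi Psi : CV -> CV -> C) :
  Cn n (uncurried Phi) -> Cn n (uncurried Psi) -> Cn n (integrand Phi Psi).
Proof. by move=> cP cQ; apply: CnM (Cn_weight n) _; apply: CnM cP (Cn_conj cQ). Qed.

Lemma continuous_fibre_section (H : CV -> C) : holomorphic H ->
  continuous (uncurried (fun=> H)).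
Proof.
move=> dH; apply: (continuous_compT (@continuous_snd _ _)) => z.
exact: differentiable_continuous.
Qed.

Lemma conjcM (a b : C) : ((a * b)^*)%C = (a^*)%C * (b^*)%C.
Proof. exact: rmorphM. Qed.

Lemma conjcD (a b : C) : ((a + b)^*)%C = (a^*)%C + (b^*)%C.
Proof. exact: rmorphD. Qed.

Lemma integrand_conj (Phi Psi : CV -> CV -> C) p :
  integrand Psi Phi p = ((integrand Phi Psi p)^*)%C.
Proof.
have wJ : ((weight p)^*)%C = weight p by rewrite weight_real; exact: conjc_real.
have E (a b c : C) : (a^*)%C = a -> ((a * (b * (c^*)%C))^*)%C = a * (c * (b^*)%C).
  by move=> aJ; rewrite !conjcM conjcK aJ [_ * c]mulrC.
by rewrite /integrand E.
Qed.

(** A factor cexp A common to both sections multiplies the product by exp (2 Re A), and the change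
    of weight has to cancel this. All lattice periods of the integrand are instances, with A = 0 for
    the integral translations. *)
Lemma integrand_quasi (Phi Psi : CV -> CV -> C) p q A :
  Phi q.1 q.2 = cexp A * Phi p.1 p.2 -> Psi q.1 q.2 = cexp A * Psi p.1 p.2 ->
  log_weight q + 2 * complex.Re A = log_weight p ->
  integrand Phi Psi q = integrand Phi Psi p.
Proof.
move=> eP eQ eA; rewrite /integrand eP eQ conjcM cexp_conj /weight.
have E (a b c d e : C) : a * (b * c * (d * e)) = a * (b * d) * (c * e) by ring.
rewrite E -!cexpD; congr (_ * _); congr cexp.
by rewrite addcJ -eA rmorphD; congr (_ + _); rewrite rmorphM rmorph_nat.
Qed.

Lemma fibre_lattice_real (xi z : CV) (l : 'cV[int]_g) :
  log_weight (xi, z + ofZ l) = log_weight (xi, z).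
Proof. by rewrite /log_weight /= tau_coordD tau_coord_ofZ addr0. Qed.

Lemma Re_piCi (c : R) (d : C) : complex.Re (c%:C * 'i%C * d) = - c * complex.Im d.
Proof. by rewrite !ReImE /=; ring. Qed.

Lemma Im_dotv_ofZ (l : 'cV[int]_g) (u : CV) :
  complex.Im (dotv (ofZ l) u) = t * dotv (map_mx intr l) (y u).
Proof.
rewrite -Im_dotv_ofR; congr (complex.Im (dotv _ u)).
by apply/matrixP => i j; rewrite !mxE rmorph_int.
Qed.

(** The logarithm of the modulus of the factor is pi t l^t (2 a + 2 K y + K l), as Re (-pi i w) = pi
    Im w. By symmetry of K this is half of what the exponent of the weight loses when y becomes y +
    l. *)
Lemma fibre_lattice_tau (xi z : CV) (l : 'cV[int]_g) :
  log_weight (xi, z + tau *: ofZ l) + 2 * complex.Re (- piC * 'i%C *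
    dotv (ofZ l) (2 *: xi + 2 *: (KC *m z) + tau *: KC *m ofZ l)) = log_weight (xi, z).
Proof.
rewrite -rmorphN Re_piCi opprK Im_dotv_ofZ -scalemxAl (scalemxAr tau).
have two (v : CV) : y (2 *: v) = 2 *: y v.
  by rewrite -(rmorph_nat (real_complex R)) tau_coordZ.
rewrite !tau_coordD !two !tau_coord_KC /log_weight /= tau_coordD tau_coord_tau_ofZ.
rewrite mulmxDr !(dotvDl, dotvDr, dotvZr, dotvZl).
rewrite (dotv_mulmx _ (y z) (map_mx intr l)) KR_sym.
ring.
Qed.

Lemma base_lattice_tau (xi z : CV) (m : 'cV[int]_g) :
  log_weight (xi + tau *: ofZ m, z) +
    2 * complex.Re (- (2 * piC * 'i%C * dotv (ofZ m) z)) = log_weight (xi, z).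
Proof.
have -> : - (2 * piC * 'i%C * dotv (ofZ m) z) = (- (2 * pi))%:C * 'i%C * dotv (ofZ m) z.
  by rewrite rmorphN rmorphM rmorph_nat; ring.
rewrite Re_piCi Im_dotv_ofZ /log_weight /= tau_coordD tau_coord_tau_ofZ.
rewrite !(dotvDl, dotvDr, dotvZr, dotvZl) (dotvC (map_mx intr m)).
ring.
Qed.

Section PairOfSections.
Variables (Phi Psi : CV -> CV -> C).
Hypotheses (sPhi : C_section tau K Phi) (sPsi : C_section tau K Psi).

Lemma integrand_fibre_period (l : 'cV[int]_g) xi z :
  integrand Phi Psi (xi, z + ofZ l) = integrand Phi Psi (xi, z).
Proof.
case: sPhi => _ wP _ _; case: sPsi => _ wQ _ _.
have [[_ pP _] [_ pQ _]] := (wP xi, wQ xi).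
by apply: (integrand_quasi (A := 0)); rewrite ?cexp0 ?mul1r /= ?pP ?pQ ?mulr0 ?addr0 ?fibre_lattice_real.
Qed.

Lemma integrand_fibre_period_tau (l : 'cV[int]_g) xi z :
  integrand Phi Psi (xi, z + tau *: ofZ l) = integrand Phi Psi (xi, z).
Proof.
case: sPhi => _ wP _ _; case: sPsi => _ wQ _ _.
have [[_ _ pP] [_ _ pQ]] := (wP xi, wQ xi).
exact: (integrand_quasi (pP l z) (pQ l z) (fibre_lattice_tau xi z l)).
Qed.

Lemma integrand_base_period (m : 'cV[int]_g) xi z :
  integrand Phi Psi (xi + ofZ m, z) = integrand Phi Psi (xi, z).
Proof.
case: sPhi => _ _ pP _; case: sPsi => _ _ pQ _.
apply: (integrand_quasi (A := 0)); rewrite ?cexp0 ?mul1r /= ?pP ?pQ ?mulr0 ?addr0//.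
by rewrite /log_weight /= tau_coordD tau_coord_ofZ addr0.
Qed.

Lemma integrand_base_period_tau (m : 'cV[int]_g) xi z :
  integrand Phi Psi (xi + tau *: ofZ m, z) = integrand Phi Psi (xi, z).
Proof.
case: sPhi => _ _ _ pP; case: sPsi => _ _ _ pQ.
exact: (integrand_quasi (pP m xi z) (pQ m xi z) (base_lattice_tau xi z m)).
Qed.

Lemma torus_function_h_c : torus_function tau (h_c tau K Phi Psi).
Proof.
split.
- move=> n; rewrite (_ : h_c tau K Phi Psi = fibre_integral tau (integrand Phi Psi)).
    apply: Cn_fibre_integral; apply: Cn_integrand.
      by case: sPhi => + _ _ _; apply.
    by case: sPsi => + _ _ _; apply.
  by apply/funext => xi; exact: h_cE.
- move=> m xi; rewrite !h_cE; congr cube_cintegral; apply/funext => w.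
  exact: integrand_base_period.
- move=> m xi; rewrite !h_cE; congr cube_cintegral; apply/funext => w.
  exact: integrand_base_period_tau.
Qed.

End PairOfSections.

Lemma Wprod_linear xi (c : C) H1 H2 H3 : Wspace tau K xi H1 -> Wspace tau K xi H2 ->
  Wspace tau K xi H3 ->
  Wprod tau K xi (fun z => c * H1 z + H2 z) H3 =
  c * Wprod tau K xi H1 H3 + Wprod tau K xi H2 H3.
Proof.
move=> [h1 _ _] [h2 _ _] [h3 _ _]; rewrite !Wprod_integrand.
have c1 := continuous_integrand (continuous_fibre_section h1) (continuous_fibre_section h3).
have c2 := continuous_integrand (continuous_fibre_section h2) (continuous_fibre_section h3).
rewrite -(@fibre_integralZ R g tau c _ xi c1).
have c3 := continuous_mulT (@cst_continuous _ _ c) c1.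
rewrite -(@fibre_integralD R g tau _ _ xi c3 c2).
congr cube_cintegral; apply/funext => w; rewrite /integrand /=; ring.
Qed.

Lemma Wprod_conj xi H1 H2 : Wspace tau K xi H1 -> Wspace tau K xi H2 ->
  Wprod tau K xi H2 H1 = ((Wprod tau K xi H1 H2)^*)%C.
Proof.
move=> [h1 _ _] [h2 _ _]; rewrite !Wprod_integrand.
have c1 := continuous_integrand (continuous_fibre_section h1) (continuous_fibre_section h2).
rewrite -cube_cintegral_conj; last exact: continuous_fibre1.
by congr cube_cintegral; apply/funext => w; exact: integrand_conj.
Qed.

Lemma torus_pointD (w e : 'cV[R]_(g + g)) : torus_point tau (w + e) = torus_point tau w + torus_point tau e.
Proof. by rewrite -[e]scale1r torus_point_affine !scale1r. Qed.

Lemma torus_point_int (m : 'cV[int]_(g + g)) :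
  torus_point tau (map_mx intr m) = ofZ (usubmx m) + tau *: ofZ (dsubmx m).
Proof. by apply/matrixP => i j; rewrite !mxE !rmorph_int. Qed.

Lemma Wprod_gt0 xi H : Wspace tau K xi H -> (exists z, H z != 0) ->
  0 < Wprod tau K xi H H.
Proof.
move=> [hH pH qH] [z Hz].
have [w wz] := torus_point_surj tau_gt0 z.
(* The point where H is nonzero may lie outside the cube. Removing the integer parts of its real
   coordinates brings it inside, and H stays nonzero because the automorphy relations would carry a
   zero back to z. *)
pose m : 'cV[int]_(g + g) := \col_k Num.floor (w k 0).
pose w0 := w - map_mx intr m.
have w01 k : w0 k 0 \in `[0, 1].
  have /andP[f1 f2] := floor_itv (w k 0).
  rewrite intrD in f2.
  by rewrite !mxE in_itv/= subr_ge0 f1 /= lerBlDl ltW.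
have Hw0 : H (torus_point tau w0) != 0.
  apply: contra Hz => /eqP Hw0; apply/eqP.
  have -> : z = torus_point tau w0 + ofZ (usubmx m) + tau *: ofZ (dsubmx m).
    by rewrite -addrA -torus_point_int -torus_pointD subrK.
  by rewrite qH pH Hw0 mulr0.
have c := continuous_integrand (continuous_fibre_section hH) (continuous_fibre_section hH).
have cw := continuous_fibre1 (tau := tau) (xi := xi) c.
pose N (c : C) := complex.Re c ^+ 2 + complex.Im c ^+ 2.
have iE p : integrand (fun=> H) (fun=> H) p = (expR (log_weight p) * N (H p.2))%:C.
  by rewrite /integrand weight_real -sqr_normc -add_Re2_Im2 -rmorphM.
rewrite Wprod_integrand ltcE; apply/andP; split.
  apply/eqP; rewrite -[RHS](@cube_integral_cst R (g + g) 0).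
  by congr cube_integral; apply/funext => w1; rewrite iE.
apply: (@cube_integral_gt0 R (g + g) _ w0 (continuous_ReT cw)) => //.
  by move=> w1; rewrite iE /= mulr_ge0 ?expR_ge0// addr_ge0 ?sqr_ge0.
rewrite iE /= mulr_gt0 ?expR_gt0//.
by rewrite -ltcR add_Re2_Im2 exprn_gt0// normr_gt0.
Qed.

Lemma hermitian_metric_h_c : hermitian_metric tau K.
Proof.
split.
- exact: Wprod_linear.
- exact: Wprod_conj.
- exact: Wprod_gt0.
- exact: torus_function_h_c.
Qed.

(** * The covariant derivative and its properties *)

Definition nabla (v : CV) (Phi : CV -> CV -> C) (xi z : CV) : C :=
  rderive (horizontal v) (uncurried Phi) (xi, z) + connection_coef v xi * Phi xi z.

Lemma horizontalD u v : horizontal (u + v) = horizontal u + horizontal v.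
Proof. by congr pair; rewrite /= KinvD opprD. Qed.

Lemma horizontalE v : horizontal v = (v, 0) + (0, - Kinv v).
Proof. by congr pair; rewrite /= ?addr0 ?add0r. Qed.

Lemma horizontalZ c v : horizontal (c *: v) = c *: horizontal v.
Proof. by congr pair; rewrite /= KinvZ scalerN. Qed.

Lemma connection_coefD u v xi :
  connection_coef (u + v) xi = connection_coef u xi + connection_coef v xi.
Proof. by rewrite /connection_coef KinvD dotvDr mulrDr. Qed.

Lemma connection_coefZ c v xi : connection_coef (c *: v) xi = c * connection_coef v xi.
Proof. by rewrite /connection_coef KinvZ dotvZr mulrCA. Qed.

Lemma ofR_affine (a b : 'cV[R]_g) (s : R) : ofR (a + s *: b) = ofR a + s%:C *: ofR b.
Proof. by apply/matrixP => i j; rewrite !mxE rmorphD rmorphM. Qed.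

(** The coefficient depends on its base point real linearly, so its derivative along w is its own
    value at w. This explains later terms such as [connection_coef v u], with a direction in the
    place of a point. *)
Lemma connection_coef_affine v w : affine_along (connection_coef v) w (connection_coef v w).
Proof.
move=> p s; rewrite /connection_coef tau_coord_affine.
rewrite ofR_affine dotvDl dotvZl; ring.
Qed.

Lemma connection_coef0 v : connection_coef v 0 = 0.
Proof.
have y0 : y (0 : CV) = 0 by apply/matrixP => i j; rewrite !mxE /= mul0r.
by rewrite /connection_coef y0 dotvE big1 ?mulr0// => j _; rewrite 2!mxE rmorph0 mul0r.
Qed.

Lemma connection_coef_ofZ v xi (m : 'cV[int]_g) :
  connection_coef v (xi + ofZ m) = connection_coef v xi.
Proof. by rewrite /connection_coef tau_coordD tau_coord_ofZ addr0. Qed.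

(** This jump is opposite to the slope of the Poincaré exponent -2 pi i m^t z along [horizontal v],
    as required by [nabla_quasi]. *)
Lemma connection_coef_tau_ofZ v xi (m : 'cV[int]_g) :
  connection_coef v (xi + tau *: ofZ m) =
  connection_coef v xi - 2 * piC * 'i%C * dotv (ofZ m) (Kinv v).
Proof.
rewrite /connection_coef tau_coordD tau_coord_tau_ofZ.
have -> : ofZ m = ofR (map_mx intr m : 'cV[R]_g).
  by apply/matrixP => i j; rewrite !mxE rmorph_int.
by rewrite -{1}[map_mx intr m]scale1r ofR_affine scale1r dotvDl; ring.
Qed.

Lemma Cn_connection_coef n v : Cn n (connection_coef v).
Proof.
apply: (@Cn_affine R CV n _ (connection_coef v)); last exact: connection_coef_affine.
apply: (continuous_mulT (@cst_continuous _ _ _)).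
rewrite (_ : (fun x => _) = fun xi : CV => \sum_j (y xi j 0)%:C * Kinv v j 0); last first.
  by apply/funext => xi; rewrite dotvE; apply: eq_bigr => j _; rewrite mxE.
apply: continuous_sumT => j; apply: continuous_mulT; last exact: cst_continuous.
have := Cn_continuous (Cn_tau_coord_fst 0 j).
move=> /(continuous_compT (f := fun xi : CV => (xi, 0 : CV))); apply.
by apply: continuous_pairT => [x|]; [exact: cvg_id|exact: cst_continuous].
Qed.

Lemma Cn_connection_coef_fst n v : Cn n (fun p : CV * CV => connection_coef v p.1).
Proof.
exact: (Cn_comp_affine (L := fst) (@continuous_fst _ _) (fun _ _ _ => erefl)
  (Cn_connection_coef n v)).
Qed.

Lemma is_rderive_connection_coef_fst u v p :
  is_rderive (fun p : CV * CV => connection_coef v p.1) u p (connection_coef v u.1).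
Proof. by apply: is_rderive_affine => q s; exact: connection_coef_affine. Qed.

Lemma nabla_uncurried v Phi : uncurried (nabla v Phi) =
  fun p => rderive (horizontal v) (uncurried Phi) p + connection_coef v p.1 * uncurried Phi p.
Proof. by apply/funext => -[xi z]. Qed.

Lemma nabla_uncurriedE v Phi p : uncurried (nabla v Phi) p =
  rderive (horizontal v) (uncurried Phi) p + connection_coef v p.1 * uncurried Phi p.
Proof. by rewrite nabla_uncurried. Qed.

Lemma Cn_nabla n v Phi : Cn n.+1 (uncurried Phi) -> Cn n (uncurried (nabla v Phi)).
Proof.
move=> cP; rewrite nabla_uncurried; apply: CnD; first exact: (CnS cP).
by apply: CnM; [exact: Cn_connection_coef_fst|exact: CnW].
Qed.

(* An automorphy relation of Phi under translation by c is inherited by its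
   covariant derivative as soon as the jump of connection_coef cancels the slope
   of the exponent A along the horizontal direction. *)
Lemma nabla_quasi Phi v c A d p : Cn 1 (uncurried Phi) ->
  (forall q, uncurried Phi (q + c) = cexp (A q) * uncurried Phi q) ->
  affine_along A (horizontal v) d ->
  d + connection_coef v (p.1 + c.1) = connection_coef v p.1 ->
  uncurried (nabla v Phi) (p + c) = cexp (A p) * uncurried (nabla v Phi) p.
Proof.
move=> cP qP aA ec; rewrite nabla_uncurried.
have D1 := is_rderive_translate (Cn_rderive (horizontal v) (p + c) cP).
have D2 := is_rderiveM (is_rderive_cexp (is_rderive_affine p aA)) (Cn_rderive (horizontal v) p cP).
have -> : rderive (horizontal v) (uncurried Phi) (p + c) =
    d * cexp (A p) * uncurried Phi p + cexp (A p) * rderive (horizontal v) (uncurried Phi) p.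
  apply: is_cderive_unique D1 _; move: D2; apply: eq_is_cderive => s.
  by rewrite qP.
rewrite qP -ec /=; ring.
Qed.

Section OneSection.
Variable Phi : CV -> CV -> C.
Hypothesis sPhi : C_section tau K Phi.

Lemma C_section_Cn n : Cn n (uncurried Phi).
Proof. by case: sPhi => + _ _ _; apply. Qed.

Lemma rderive_pair_fst v xi z :
  rderive v (Phi ^~ z) xi = rderive (v, 0) (uncurried Phi) (xi, z).
Proof.
apply: rderiveE; have := Cn_rderive (v, 0) (xi, z) (C_section_Cn 1).
by apply: eq_is_cderive => s; rewrite /uncurried /= scaler0 addr0.
Qed.

Lemma rderive_snd_i (w : CV) p :
  rderive (0, 'i%C *: w) (uncurried Phi) p = 'i%C * rderive (0, w) (uncurried Phi) p.
Proof.
case: p => xi z; case: sPhi => _ /(_ xi)[dP _ _] _ _.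
have E u : rderive (0, u) (uncurried Phi) (xi, z) = rderive u (Phi xi) z.
  apply/esym/rderiveE; have := Cn_rderive (0, u) (xi, z) (C_section_Cn 1).
  by apply: eq_is_cderive => s; rewrite /uncurried /= scaler0 addr0.
by rewrite !E; exact: differentiable_rderive_i.
Qed.

Lemma nabla_holomorphic v xi : holomorphic (nabla v Phi xi).
Proof.
have cn := Cn_nabla v (C_section_Cn 2).
have cL : continuous (fun z : CV => (xi, z)).
  by apply: continuous_pairT => [|x]; [exact: cst_continuous|exact: cvg_id].
have aL (w z : CV) (s : R) : (xi, z + s%:C *: w) = (xi, z) + s%:C *: ((0, w) : CV * CV).
  by congr pair; rewrite /= scaler0 addr0.
have c1 : Cn 1 (nabla v Phi xi).
  exact: (Cn_comp_affine (dL := fun w => (0, w)) cL aL cn).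
move=> z; apply: Cauchy_Riemann_differentiable => // {z} w z.
(* The coefficient is independent of z, and mixed derivatives commute, so differentiating in z only
   affects Phi. Its z-derivative is complex linear in u, and the Cauchy-Riemann equations of the
   covariant derivative follow. *)
have E u : rderive u (nabla v Phi xi) z =
    rderive (horizontal v) (rderive (0, u) (uncurried Phi)) (xi, z) +
    connection_coef v xi * rderive (0, u) (uncurried Phi) (xi, z).
  rewrite -rderive_sym; last exact: C_section_Cn.
  apply: rderiveE.
  have D1 := Cn_rderive (0, u) (xi, z) (CnS (C_section_Cn 2) (horizontal v)).
  have D2 := Cn_rderive (0, u) (xi, z) (C_section_Cn 1).
  have D3 := is_rderive_connection_coef_fst (0, u) v (xi, z).
  have := is_rderiveD D1 (is_rderiveM D3 D2).
  rewrite connection_coef0 mul0r add0r; apply: eq_is_cderive => s.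
  by rewrite -aL /nabla.
rewrite !E.
have -> : rderive (0, 'i%C *: w) (uncurried Phi) =
    fun p => 'i%C * rderive (0, w) (uncurried Phi) p.
  by apply/funext => p; exact: rderive_snd_i.
have -> : rderive (horizontal v) (fun p => 'i%C * rderive (0, w) (uncurried Phi) p) (xi, z) =
    'i%C * rderive (horizontal v) (rderive (0, w) (uncurried Phi)) (xi, z).
  apply: rderiveE.
  have := is_rderiveM (is_rderive_cst 'i%C (horizontal v) (xi, z))
    (Cn_rderive (horizontal v) (xi, z) (CnS (C_section_Cn 2) (0, w))).
  by rewrite mul0r add0r.
ring.
Qed.

Lemma nabla_C_section v : C_section tau K (nabla v Phi).
Proof.
have c1 := C_section_Cn 1.
have zero : affine_along (fun _ : CV * CV => 0 : C) (horizontal v) 0.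
  by move=> p s; rewrite mulr0 addr0.
have c0 (xi : CV) : 0 + connection_coef v (xi + 0) = connection_coef v xi.
  by rewrite add0r addr0.
split.
- by move=> n; exact: (Cn_nabla v (C_section_Cn n.+1)).
- move=> xi; split; first exact: nabla_holomorphic.
  + move=> l z.
    have := @nabla_quasi Phi v (0, ofZ l) (fun=> 0) 0 (xi, z) c1 _ zero (c0 xi).
    rewrite cexp0 mul1r /uncurried /= addr0; apply=> -[xi' z'].
    by rewrite mul1r /= addr0; case: sPhi => _ /(_ xi')[_ + _] _ _; apply.
  + move=> l z.
    pose A (p : CV * CV) := - piC * 'i%C *
      dotv (ofZ l) (2 *: p.1 + 2 *: (KC *m p.2) + tau *: KC *m ofZ l).
    (* Slope 0 because xi + K z is constant along [horizontal v]; accordingly the coefficient need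
       not jump under translations in z. *)
    have aA : affine_along A (horizontal v) 0.
      move=> p s; rewrite /A /= mulmxDr -scalemxAr mulmxN mulKC_Kinv.
      by rewrite !(dotvDr, dotvZr, dotvNr); ring.
    have := @nabla_quasi Phi v (0, tau *: ofZ l) A 0 (xi, z) c1 _ aA (c0 xi).
    rewrite /uncurried /= addr0; apply=> -[xi' z'].
    by rewrite /= addr0; case: sPhi => _ /(_ xi')[_ _ +] _ _; apply.
- move=> m xi z.
  have := @nabla_quasi Phi v (ofZ m, 0) (fun=> 0) 0 (xi, z) c1 _ zero.
  rewrite cexp0 mul1r /uncurried /= addr0; apply.
    move=> -[xi' z']; rewrite mul1r /= addr0.
    by case: sPhi => _ _ + _; apply.
  by rewrite add0r connection_coef_ofZ.
- move=> m xi z.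
  pose A (p : CV * CV) := - (2 * piC * 'i%C * dotv (ofZ m) p.2).
  have aA : affine_along A (horizontal v) (2 * piC * 'i%C * dotv (ofZ m) (Kinv v)).
    by move=> p s; rewrite /A /= !(dotvDr, dotvZr, dotvNr); ring.
  have := @nabla_quasi Phi v (tau *: ofZ m, 0) A _ (xi, z) c1 _ aA.
  rewrite /uncurried /= addr0; apply.
    move=> -[xi' z']; rewrite /= addr0.
    by case: sPhi => _ _ _; apply.
  by rewrite connection_coef_tau_ofZ addrC subrK.
Qed.

(** The vertical derivative along -K^-1 v and the coefficient are both complex linear in v, the
    former because Phi is holomorphic in z. Hence [part01] kills them and leaves the derivative in
    xi. *)
Lemma nabla_dbar v xi z : part01 (fun u => nabla u Phi xi z) v = dbar Phi v xi z.
Proof.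
rewrite /dbar /part01 !rderive_pair_fst /nabla; congr (_ * _).
have E u : rderive (horizontal u) (uncurried Phi) (xi, z) =
    rderive (u, 0) (uncurried Phi) (xi, z) + rderive (0, - Kinv u) (uncurried Phi) (xi, z).
  by rewrite horizontalE; apply: rderive_dirD; exact: C_section_Cn.
have Ei : rderive (0, - Kinv ('i%C *: v)) (uncurried Phi) (xi, z) =
    'i%C * rderive (0, - Kinv v) (uncurried Phi) (xi, z).
  by rewrite KinvZ -scalerN; exact: rderive_snd_i.
rewrite (E v) (E ('i%C *: v)) Ei connection_coefZ.
have key (i a b c d a' : C) : i * i = -1 ->
    a + b + c * d + i * (a' + i * b + i * c * d) = a + i * a'.
  move=> ii; have -> : a + b + c * d + i * (a' + i * b + i * c * d) =
    a + i * a' + (1 + i * i) * (b + c * d) by ring.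
  by rewrite ii subrr mul0r addr0.
by apply: key; rewrite -expr2 sqr_i.
Qed.

End OneSection.

Lemma nabla_connection : connection tau K nabla.
Proof.
refine (Connection _ _ _ _ _).
- by move=> v Phi sPhi; exact: nabla_C_section.
- move=> u v Phi sPhi xi z; rewrite /nabla horizontalD connection_coefD.
  by rewrite (rderive_dirD _ _ _ (C_section_Cn sPhi 1)) mulrDl addrACA.
- move=> r v Phi sPhi xi z; rewrite /nabla horizontalZ connection_coefZ.
  have [dP _] := proj2 (C_section_Cn sPhi 1) (horizontal v).
  by rewrite (rderive_dirZ _ (dP _)) mulrDr mulrA.
- move=> v Phi Psi sPhi sPsi xi z; rewrite /nabla.
  rewrite (rderiveE (is_rderiveD (Cn_rderive (horizontal v) (xi, z) (C_section_Cn sPhi 1))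
    (Cn_rderive (horizontal v) (xi, z) (C_section_Cn sPsi 1)))).
  by rewrite mulrDr addrACA.
- move=> v f Phi [sf _ _] sPhi xi z; rewrite /nabla.
  have df : is_rderive (fun p : CV * CV => f p.1) (horizontal v) (xi, z) (rderive v f xi).
    exact: (Cn_rderive v xi (sf 1%N)).
  rewrite (rderiveE (is_rderiveM df (Cn_rderive (horizontal v) (xi, z) (C_section_Cn sPhi 1)))).
  by rewrite mulrDr addrA mulrCA.
Qed.

Lemma nabla_hermitian v Phi Psi : C_section tau K Phi -> C_section tau K Psi ->
  forall xi, rderive v (h_c tau K Phi Psi) xi =
    h_c tau K (nabla v Phi) Psi xi + h_c tau K Phi (nabla v Psi) xi.
Proof.
move=> sPhi sPsi xi.
have [cP cQ] := (C_section_Cn sPhi, C_section_Cn sPsi).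
have cS := Cn_integrand (cP 1%N) (cQ 1%N).
have -> : h_c tau K Phi Psi = fibre_integral tau (integrand Phi Psi).
  by apply/funext => xi'; exact: h_cE.
rewrite (rderiveE (@is_rderive_fibre_integral R g tau _ v xi cS)) !h_cE.
have cN := Cn_continuous (Cn_integrand (Cn_nabla v (cP 1%N)) (cQ 0%N)).
have cM := Cn_continuous (Cn_integrand (cP 0%N) (Cn_nabla v (cQ 1%N))).
rewrite -(@fibre_integralD R g tau _ _ xi cN cM).
have ch w : continuous (rderive w (integrand Phi Psi)) by case: cS => _ /(_ w)[].
(* The vertical derivative along -K^-1 v has integral 0 over the fibre. Adding it turns the
   direction (v, 0) into [horizontal v], where the weight contributes exactly the coefficient and
   its conjugate. *)
rewrite -[LHS]addr0 -(fibre_integral_derive_periodic tau_gt0 (- Kinv v) cS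
  (fun l z => integrand_fibre_period sPhi sPsi l xi z)
  (fun l z => integrand_fibre_period_tau sPhi sPsi l xi z)).
rewrite -(@fibre_integralD R g tau _ _ xi (ch _) (ch _)).
congr cube_cintegral; apply/funext => w; set p := (xi, _).
rewrite -(rderive_dirD _ _ _ cS) -horizontalE.
have D := is_rderiveM (is_rderive_cexp (is_rderive_log_weight v p))
  (is_rderiveM (Cn_rderive (horizontal v) p (cP 1%N))
     (is_rderive_conj (Cn_rderive (horizontal v) p (cQ 1%N)))).
rewrite (rderiveE D).
have key (w0 c c' a a' b b' : C) : (c + c') * w0 * (a * b) + w0 * (a' * b + a * b') =
    w0 * ((a' + c * a) * b) + w0 * (a * (b' + c' * b)) by ring.
by rewrite key -conjcM -conjcD /integrand -!nabla_uncurriedE.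
Qed.

Lemma nabla_chern : chern_connection tau K nabla.
Proof.
refine (ChernConnection _ _ _).
- exact: nabla_connection.
- exact: nabla_hermitian.
- by move=> v Phi sPhi xi z; exact: nabla_dbar.
Qed.

(** * Uniqueness of the Chern connection *)

Section Uniqueness.
Variable nabla' : CV -> (CV -> CV -> C) -> CV -> CV -> C.
Hypothesis chern' : chern_connection tau K nabla'.

(** Written in the shape c * _ + _ so that the linearity statements for [Wprod] and for holomorphic
    functions apply directly. *)
Let D u Phi xi z := (-1) * nabla u Phi xi z + nabla' u Phi xi z.

(** The two connections have the same (0,1)-part, so that of D vanishes: D_u + i D_{iu} = 0. *)
Lemma difference_i u Phi xi z : C_section tau K Phi ->
  D ('i%C *: u) Phi xi z = 'i%C * D u Phi xi z.
Proof.
move=> sPhi; have := chern_dbar chern' u sPhi xi z.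
rewrite -(nabla_dbar sPhi) /part01.
have h2 : (2^-1 : C) != 0 by rewrite invr_eq0 pnatr_eq0.
move=> /(mulfI h2); rewrite /D.
have key (i a b a' b' : C) : i * i = -1 -> a' + i * b' = a + i * b ->
    (-1) * b + b' = i * ((-1) * a + a').
  move=> ii e.
  have -> : i * ((-1) * a + a') =
      i * (a' + i * b' - (a + i * b)) - (i * i) * (b' - b) by ring.
  by rewrite e ii; ring.
by apply: key; rewrite -expr2 sqr_i.
Qed.

Lemma difference_C_section u Phi : C_section tau K Phi -> C_section tau K (D u Phi).
Proof.
move=> sPhi.
have [s1 w1 p1 q1] := connection_section (chern_is_connection chern') u sPhi.
have [s2 w2 p2 q2] := nabla_C_section sPhi u.
split.
- move=> n; apply: (@CnD R (CV * CV)%type n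
    (fun p => (-1) * nabla u Phi p.1 p.2) (fun p => nabla' u Phi p.1 p.2)) (s1 n).
  by apply: (CnM (@Cn_cst R (CV * CV)%type n (-1)) (s2 n)).
- move=> xi; have [h1 r1 t1] := w1 xi; have [h2 r2 t2] := w2 xi.
  split.
  + exact: (holomorphic_linear (-1) h2 h1).
  + by move=> l z; rewrite /D r1 r2.
  + by move=> l z; rewrite /D t1 t2 mulrCA -mulrDr.
- by move=> m xi z; rewrite /D p1 p2.
- by move=> m xi z; rewrite /D q1 q2 mulrCA -mulrDr.
Qed.

Lemma h_c_linear (c : C) (P1 P2 P3 : CV -> CV -> C) xi :
  C_section tau K P1 -> C_section tau K P2 -> C_section tau K P3 ->
  h_c tau K (fun xi z => c * P1 xi z + P2 xi z) P3 xi =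
  c * h_c tau K P1 P3 xi + h_c tau K P2 P3 xi.
Proof.
by move=> [_ w1 _ _] [_ w2 _ _] [_ w3 _ _]; exact: (Wprod_linear c (w1 xi) (w2 xi) (w3 xi)).
Qed.

Lemma h_c_conj (P1 P2 : CV -> CV -> C) xi :
  C_section tau K P1 -> C_section tau K P2 ->
  h_c tau K P2 P1 xi = ((h_c tau K P1 P2 xi)^*)%C.
Proof. by move=> [_ w1 _ _] [_ w2 _ _]; exact: (Wprod_conj (w1 xi) (w2 xi)). Qed.

Lemma h_c_difference_skew u Phi Psi xi : C_section tau K Phi -> C_section tau K Psi ->
  h_c tau K (D u Phi) Psi xi + h_c tau K Phi (D u Psi) xi = 0.
Proof.
move=> sP sQ.
have s1 := connection_section (chern_is_connection chern') u.
have s2 P := @nabla_C_section P ^~ u.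
have := chern_hermitian chern' u sP sQ xi.
rewrite (nabla_hermitian u sP sQ) => e.
rewrite (h_c_conj xi (difference_C_section u sQ) sP).
rewrite (h_c_linear _ _ (s2 _ sP) (s1 _ sP) sQ) (h_c_linear _ _ (s2 _ sQ) (s1 _ sQ) sP).
rewrite conjcD conjcM -!(h_c_conj xi _ sP); [|exact: s1|exact: s2].
have -> : ((-1 : C)^*)%C = -1 by rewrite rmorphN rmorph1.
have key (a b a' b' : C) : a + b = a' + b' -> (-1) * a + a' + ((-1) * b + b') = 0.
  by move=> e'; rewrite addrACA -mulrDr e' mulN1r addNr.
exact: key.
Qed.

(** Put a = h_c (D_u Phi, Psi) and b = h_c (Phi, D_u Psi). Skewness for u gives a + b = 0; for i u
    it gives i a - i b = 0, the metric being conjugate linear in its second argument. Hence a =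
    0. *)
Lemma h_c_difference0 u Phi Psi xi : C_section tau K Phi -> C_section tau K Psi ->
  h_c tau K (D u Phi) Psi xi = 0.
Proof.
move=> sP sQ.
have scale P Q : C_section tau K P -> C_section tau K Q ->
    h_c tau K (D ('i%C *: u) P) Q xi = 'i%C * h_c tau K (D u P) Q xi.
  move=> sP' sQ'; have sD := difference_C_section u sP'.
  (* The multiple i D is split as (i - 1) D + D to fit [h_c_linear]. *)
  rewrite (_ : D ('i%C *: u) P = fun xi z => ('i%C - 1) * D u P xi z + D u P xi z).
    by rewrite (h_c_linear _ _ sD sD sQ'); ring.
  apply/funext => xi'; apply/funext => z'.
  by rewrite difference_i// mulrBl mul1r subrK.
have e1 := h_c_difference_skew u xi sP sQ.
have := h_c_difference_skew ('i%C *: u) xi sP sQ.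
rewrite (scale _ _ sP sQ) (h_c_conj xi (difference_C_section _ sQ) sP) (scale _ _ sQ sP).
rewrite conjcM -(h_c_conj xi (difference_C_section u sQ) sP).
have -> : (('i%C : C)^*)%C = - 'i%C by apply: complex_eq; rewrite /= ?oppr0.
have i0 : ('i%C : C) != 0 by apply/eqP => /(congr1 (@complex.Im R)) /eqP; rewrite /= oner_eq0.
have key (a b i : C) : i != 0 -> a + b = 0 -> i * a + - i * b = 0 -> a = 0.
  move=> i0' e2; rewrite mulNr -mulrBr => /eqP; rewrite mulf_eq0 (negbTE i0') /= => /eqP e3.
  have : 2 * a = 0.
    have -> : 2 * a = (a + b) + (a - b) by ring.
    by rewrite e2 e3 addr0.
  by move=> /eqP; rewrite mulf_eq0 pnatr_eq0 /= => /eqP.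
exact: key.
Qed.

Lemma chern_connection_unique v Phi : C_section tau K Phi ->
  forall xi z, nabla' v Phi xi z = nabla v Phi xi z.
Proof.
move=> sP xi z; have sD := difference_C_section v sP.
have [_ wD _ _] := sD.
have h0 := h_c_difference0 v xi sP sD.
apply/eqP; rewrite -subr_eq0; apply/negPn/negP => Dz.
have Dz' : D v Phi xi z != 0 by rewrite /D mulN1r addrC.
have := Wprod_gt0 (wD xi) (ex_intro _ z Dz').
by rewrite -/(h_c tau K (D v Phi) (D v Phi) xi) h0 ltxx.
Qed.

End Uniqueness.

(** * Curvature *)

Definition curvature_form (u v : CV) (_ : CV) : C :=
  connection_coef v u - connection_coef u v.

Lemma torus_function_cst (c : C) : torus_function tau (fun _ : CV => c).
Proof. by split=> // n; exact: Cn_cst. Qed.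

Lemma connection_coef_dirD w u v :
  connection_coef w (u + v) = connection_coef w u + connection_coef w v.
Proof.
by have := connection_coef_affine w v u 1; rewrite scale1r mul1r.
Qed.

Lemma connection_coef_dirZ w (r : R) v :
  connection_coef w (r%:C *: v) = r%:C * connection_coef w v.
Proof.
by have := connection_coef_affine w v 0 r; rewrite connection_coef0 !add0r.
Qed.

Lemma two_form_curvature : two_form tau curvature_form.
Proof.
refine (TwoForm _ _ _ _ _ _).
- by move=> u v; exact: torus_function_cst.
- by move=> u xi; rewrite /curvature_form subrr.
- by move=> u u' v xi; rewrite /curvature_form connection_coef_dirD connection_coefD; ring.
- by move=> u v v' xi; rewrite /curvature_form connection_coef_dirD connection_coefD; ring.
- by move=> r u v xi; rewrite /curvature_form connection_coef_dirZ connection_coefZ; ring.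
- by move=> r u v xi; rewrite /curvature_form connection_coef_dirZ connection_coefZ; ring.
Qed.

(** In the commutator the second derivatives of Phi cancel by symmetry, and the first-order terms
    and the products of coefficients cancel because they are symmetric in u and v. Only the
    derivatives of the coefficients survive: the exterior derivative of the connection form on two
    constant fields, which is independent of xi. *)
Lemma nabla_curvature u v Phi : C_section tau K Phi -> forall xi z,
  curvature nabla u v Phi xi z = curvature_form u v xi * Phi xi z.
Proof.
move=> sP xi z; have cP := C_section_Cn sP.
have E a b : nabla a (nabla b Phi) xi z =
    rderive (horizontal a) (rderive (horizontal b) (uncurried Phi)) (xi, z) +
    (connection_coef b a * Phi xi z +
     connection_coef b xi * rderive (horizontal a) (uncurried Phi) (xi, z)) +
    connection_coef a xi * (rderive (horizontal b) (uncurried Phi) (xi, z) +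
      connection_coef b xi * Phi xi z).
  rewrite {1}/nabla nabla_uncurried; congr (_ + _).
  apply: rderiveE; apply: is_rderiveD.
    exact: (Cn_rderive (horizontal a) (xi, z) (CnS (cP 2%N) (horizontal b))).
  exact: (is_rderiveM (is_rderive_connection_coef_fst (horizontal a) b (xi, z))
    (Cn_rderive (horizontal a) (xi, z) (cP 1%N))).
rewrite /curvature !E (rderive_sym (horizontal u) (horizontal v) (xi, z) (cP 2%N)).
have key (S a b c d e f p : C) : S + (a * p + b * c) + d * (e + b * p) -
    (S + (f * p + d * e) + b * (c + d * p)) = (a - f) * p by ring.
exact: key.
Qed.

End Bundle.

Theorem mainTheorem5 (R : realType) (g : nat) (tau : R[i]) (K : 'M[int]_g)
    (tau_gt0 : 0 < complex.Im tau) (K_sym : K^T = K) (K_posdef : posdef R K) :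
  hermitian_metric tau K /\
  exists nabla : 'cV[R[i]]_g -> ('cV[R[i]]_g -> 'cV[R[i]]_g -> R[i]) ->
                 'cV[R[i]]_g -> 'cV[R[i]]_g -> R[i],
    [/\ chern_connection tau K nabla,
        forall nabla', chern_connection tau K nabla' ->
          forall v Phi, C_section tau K Phi ->
          forall xi z, nabla' v Phi xi z = nabla v Phi xi z
      & projectively_flat tau K nabla].
Proof.
split; first exact: hermitian_metric_h_c.
exists (nabla tau K); split.
- exact: nabla_chern.
- by move=> nabla' chern' v Phi sPhi; exact: chern_connection_unique.
- exists (curvature_form tau K); first exact: two_form_curvature.
  by move=> u v Phi sPhi; exact: nabla_curvature.
Qed.
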